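(* Let $p$ be a prime with $p\equiv 1\pmod 4$, and let $a,b\in\mathbb{Z}$ be such that $p=a^2+b^2$ and $4\mid a-1$. Then $$\sum_{k=0}^{p-1}\frac{\binom{6k}{3k}\binom{3k}{k}}{864^k}\equiv \begin{cases} 2a-\dfrac{p}{2a}\pmod{p^2} & \text{if } p\equiv 1\pmod{12} \text{ and } 3\nmid a,\\[2mm] -2a+\dfrac{p}{2a}\pmod{p^2} & \text{if } p\equiv 1\pmod{12}\text{ and } 3\mid a,\\[2mm] 2b-\dfrac{p}{2b}\pmod{p^2} & \text{if } p\equiv 5\pmod{12}\text{ and } 3\mid a-b.\end{cases}$$
   Context: Congruences modulo $p^2$ are in the ring of rational numbers whose denominator is coprime to $p$. *)

(* Defs.v *)
From mathcomp Require Import all_boot all_order all_algebra.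

Set Implicit Arguments.
Unset Strict Implicit.
Unset Printing Implicit Defensive.

Import Order.TTheory GRing.Theory Num.Theory.
Local Open Scope ring_scope.

(* The subring of rat of the rationals whose denominator is coprime to p;
   [denq] is the positive denominator of the reduced fraction. *)
Definition locZ (p : nat) : {pred rat} := [pred x : rat | coprimez p (denq x)].

(* Congruence modulo the ideal of [locZ p] generated by p ^ n; both sides are
   required to belong to the ring. *)
Definition locZ_eqmod (p n : nat) (x y : rat) : Prop :=
  [/\ x \in locZ p, y \in locZ p &
      exists2 z : rat, z \in locZ p & x - y = p%:R ^+ n * z].

(* Main.v *)
From HB Require Import structures.
Require Import Defs.
From mathcomp Require Import all_boot all_order all_algebra.
From mathcomp Require Import cyclic finfield.
From mathcomp Require Import zify ring.

Set Implicit Arguments.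
Unset Strict Implicit.
Unset Printing Implicit Defensive.

Import Order.TTheory GRing.Theory Num.Theory.
Local Open Scope ring_scope.

(** Why the theorem is true. Put [h = (p-1)/2], [q = (p-1)/4], [A] the integer
    part of [p/12] and [B = h - A]; all congruences are modulo [p^2].

    The [k]-th term of the sum is [C(-1/6, k) C(-5/6, k) / 2^k], so the sum is a
    truncation of the hypergeometric series for the Legendre function [P_v(0)]
    at [v = -1/6]. Truncated at [p], this series is a polynomial in
    [s = v (v + 1)], and a polynomial is affine along increments divisible by
    [p]. Now [s = -5/36] lies on the line through the values of [v (v + 1)] at
    [v = 2A] and [v = 2B], at one sixth of the way; at those two points the
    polynomial is a genuine Legendre polynomial at the origin, hence a central
    binomial coefficient ([sextic_sum_interpolation]).

    Modulo [p^2], the reflection [n -> p - 1 - n] and the duplication and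
    triplication of factorials hold up to factors [1 + p x], where [x] is a
    combination of harmonic numbers in ['F_p]. They reduce the sum to
    [(-1)^A t(3)^q V], with [t] the Teichmuller lift and [V] a multiple of
    [C(h, q)] ([sextic_sum_unit_root]).

    Let [chi] be the quartic character of ['F_p] with values in [Z[i]] that is
    [x^q] in ['F_p], and [K] the Jacobi sum of [chi] and [chi^2]. In [Z/p^2],
    where [chi x] becomes [t(x)^q], the conjugate of [K] is [- (-1)^q V]
    ([gauss_eval_jacobi_sum]). The power of [t(1-z)] occurring there is an affine
    interpolation between two ordinary powers of [1 - t(z)], for which the
    binomial theorem leaves at most two terms.

    So the sum is the image of a Gaussian integer [z] of norm [p]. The images of
    [z] and of its conjugate have sum [2 c], with [c] the real part of [z], and
    product [p]; the first being a unit, it equals [2 c - p / (2 c)]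
    ([gauss_eval_unit_root]). It remains to find [c]. Since [K] has norm [p] and
    [K + p] is divisible by [2 (1 - i)], [- (-1)^q K] is [a + b i] or [a - b i].
    Modulo [3], the value [chi 3] is known from [K^2 = chi 4 * chi 3], which is
    Gauss's congruence for the cube of a Gauss sum, here obtained from the cyclic
    permutation of the triples of sum 1 ([quartic_jacobi_sum_mod3]). The three
    cases of the theorem are those where these data make [c] equal to [a],
    [- a] or [b]. *)

(** * Prime fields and harmonic numbers *)

Section PrimeField.

Variable p : nat.
Hypothesis p_pr : prime p.

Lemma Fp_nat_eq0 (n : nat) : (n%:R == 0 :> 'F_p) = (p %| n)%N.
Proof. by rewrite -(dvdn_pcharf (pchar_Fp p_pr)). Qed.

Lemma Fp_nat_neq0 (n : nat) : (0 < n < p)%N -> n%:R != 0 :> 'F_p.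
Proof. by case/andP=> n0 np; rewrite Fp_nat_eq0 gtnNdvd. Qed.

Lemma Fp_p_eq0 : p%:R = 0 :> 'F_p.
Proof. by apply/eqP; rewrite Fp_nat_eq0. Qed.

Lemma Fp_fermat (x : 'F_p) : x ^+ p = x.
Proof. by rewrite -[in X in _ ^+ X](card_Fp p_pr) expf_card. Qed.

Lemma Fp_fermat1 (x : 'F_p) : x != 0 -> x ^+ p.-1 = 1.
Proof.
move=> x0; apply: (mulfI x0); rewrite mulr1 -exprS prednK ?prime_gt0 //.
exact: Fp_fermat.
Qed.

(** Harmonic numbers only occur multiplied by [p], so their residues suffice. *)
Definition harmonic (n : nat) : 'F_p := \sum_(i < n) (i.+1)%:R^-1.

Lemma harmonic0 : harmonic 0 = 0.
Proof. by rewrite /harmonic big_ord0. Qed.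

Lemma harmonicS n : harmonic n.+1 = harmonic n + n.+1%:R^-1.
Proof. by rewrite /harmonic big_ord_recr. Qed.

Lemma harmonicD c n :
  harmonic (c + n) - harmonic c = \sum_(i < n) (i + c).+1%:R^-1.
Proof.
elim: n => [|n IHn]; first by rewrite addn0 big_ord0 subrr.
by rewrite big_ord_recr /= -IHn addnS harmonicS (addnC n c) addrAC.
Qed.

Lemma Fp_compl n : (n < p)%N -> (p - n)%:R = - n%:R :> 'F_p.
Proof. by move=> np; rewrite natrB 1?ltnW // Fp_p_eq0 sub0r. Qed.

(** As [1/(p - k) = - 1/k], the two sides have the same increments in [n]; they
    agree because they are the same harmonic number at [n = (p - 1)/2]. *)
Lemma harmonic_compl n : odd p -> (n < p)%N -> harmonic (p.-1 - n) = harmonic n.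
Proof.
move=> op.
have p0 := prime_gt0 p_pr.
have step k : (k < p)%N -> harmonic (p.-1 - k) = harmonic p.-1 + harmonic k.
  elim: k => [|k IHk] kp; first by rewrite harmonic0 addr0 subn0.
  have e : (p.-1 - k = (p.-1 - k.+1).+1)%N by lia.
  have := IHk (ltnW kp); rewrite e !harmonicS -e.
  have -> : (p.-1 - k = p - k.+1)%N by lia.
  rewrite Fp_compl // invrN addrA => <-; ring.
have h0 : harmonic p.-1 = 0.
  have lt : (p./2 < p)%N by lia.
  have := step _ lt; have -> : (p.-1 - p./2 = p./2)%N by lia.
  by move/eqP; rewrite -subr_eq subrr eq_sym => /eqP.
by move=> /step ->; rewrite h0 add0r.
Qed.

Lemma Fp_primitive_root : exists g : 'F_p, p.-1.-primitive_root g.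
Proof.
have p1 := prime_gt1 p_pr.
pose rs := [seq x <- enum 'F_p | x != 0].
suff /hasP[g _ gp] : has p.-1.-primitive_root rs by exists g.
apply: has_prim_root; first by lia.
- by apply/allP => x; rewrite mem_filter unity_rootE => /andP[x0 _]; rewrite Fp_fermat1.
- by rewrite filter_uniq // enum_uniq.
have -> : size rs = #|predC1 (0 : 'F_p)|.
  by rewrite cardE /rs /enum_mem; congr size; rewrite -filter_predI; apply: eq_filter => x; rewrite /= andbT.
by rewrite cardC1 card_Fp.
Qed.

Lemma Fp_exp_generator (g x : 'F_p) : p.-1.-primitive_root g -> x != 0 ->
  exists k, x = g ^+ k.
Proof.
move=> gp x0; have [|k ->] := prim_rootP gp (x := x); last by exists k.
exact: Fp_fermat1.
Qed.

Lemma Fp_sqrt_m1 : (p %% 4 = 1)%N -> exists i0 : 'F_p, i0 * i0 = -1.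
Proof.
move=> p4; have p1 := prime_gt1 p_pr.
have [g gp] := Fp_primitive_root; exists (g ^+ (p %/ 4)); rewrite -exprD.
set m := (p %/ 4 + p %/ 4)%N.
have : (g ^+ m - 1) * (g ^+ m + 1) == 0.
  apply/eqP; transitivity (g ^+ m * g ^+ m - 1); first by ring.
  rewrite -exprD; have -> : (m + m = p.-1)%N by rewrite /m; lia.
  by rewrite (prim_expr_order gp) subrr.
rewrite mulf_eq0 subr_eq0 addr_eq0 => /orP[|/eqP //].
by rewrite -(prim_order_dvd gp) => /dvdn_leq; rewrite /m; lia.
Qed.

End PrimeField.

(** * Polynomial and factorial identities *)

Lemma horner_sqr_zero (R : comNzRingType) (f : {poly R}) (s y : R) :
  y * y = 0 -> f.[s + y] = f.[s] + f^`().[s] * y.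
Proof.
move=> y0; elim/poly_ind: f => [|f c IHf]; first by rewrite deriv0 !horner0; ring.
rewrite derivD derivM derivX derivC addr0 mulr1 !hornerE IHf /=.
transitivity (f.[s] * s + c + (f.[s] + f^`().[s] * s) * y + f^`().[s] * (y * y)).
  by ring.
by rewrite y0; ring.
Qed.

Lemma coef_1DX_exp (R : comNzRingType) (m r : nat) :
  ((1 + 'X) ^+ m : {poly R})`_r = 'C(m, r)%:R.
Proof.
rewrite exprDn coef_sum.
under eq_bigr => i _ do rewrite expr1n mul1r coefMn coefXn.
have [rm|rm] := ltnP r m.+1; last first.
  rewrite bin_small // big1 // => i _; case: eqP => [e|_]; last by rewrite mul0rn.
  by have := ltn_ord i; lia.
rewrite (bigD1 (Ordinal rm)) //= eqxx big1 ?addr0 // => i ir.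
by case: eqP => [e|_]; [case/eqP: ir; apply: val_inj | rewrite mul0rn].
Qed.

(** Legendre's polynomial of even degree at the origin: both sides are the
    coefficient of ['X^(2 n)] in the two expansions of
    [(1 + 'X) ^+ (2 n) * (2 - (1 + 'X)) ^+ (2 n) = (1 - 'X^2) ^+ (2 n)]. *)
Lemma legendre_at_0 (R : comNzRingType) (n : nat) :
  \sum_(k < (n.*2).+1)
     (-1) ^+ k * 2 ^+ (n.*2 - k) * 'C(n.*2, k)%:R * 'C(n.*2 + k, k)%:R =
  (-1) ^+ n * 'C(n.*2, n)%:R :> R.
Proof.
set r := n.*2.
have e : (1 + 'X) ^+ r * (2%:P - (1 + 'X)) ^+ r = (1 - 'X ^+ 2) ^+ r :> {poly R}.
  rewrite -exprMn; congr (_ ^+ r).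
  have -> : 2%:P = 1 + 1 :> {poly R} by rewrite polyCD.
  by ring.
have := congr1 (fun f : {poly R} => f`_r) e.
rewrite [(2%:P - _) ^+ r]exprDn mulr_sumr coef_sum => e1.
transitivity (((1 - 'X ^+ 2) ^+ r : {poly R})`_r).
  rewrite -{}e1; apply: eq_bigr => i _.
  have -> : (1 + 'X) ^+ r * (2%:P ^+ (r - i) * (- (1 + 'X)) ^+ i *+ 'C(r, i)) =
     (2 ^+ (r - i) * (-1) ^+ i * 'C(r, i)%:R)%:P * (1 + 'X) ^+ (r + i) :> {poly R}.
    rewrite [(- (1 + 'X)) ^+ i]exprNn exprD !rmorphM !rmorphXn rmorphN /= rmorph1 !rmorph_nat.
    by rewrite -mulr_natr; ring.
  rewrite coefCM coef_1DX_exp -(@bin_sub (r + i) i) ?leq_addl // addnK; ring.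
have term i : (1 ^+ (r - i) * (- 'X ^+ 2) ^+ i *+ 'C(r, i) : {poly R})`_r =
    (-1) ^+ i * 'C(r, i)%:R * (i == n)%:R.
  have -> : 1 ^+ (r - i) * (- 'X ^+ 2) ^+ i *+ 'C(r, i) =
     ((-1) ^+ i * 'C(r, i)%:R)%:P * 'X ^+ (2 * i) :> {poly R}.
    rewrite expr1n mul1r [(- 'X ^+ 2) ^+ i]exprNn -exprM !rmorphM !rmorphXn rmorphN /= rmorph1.
    by rewrite !rmorph_nat -mulr_natr; ring.
  by rewrite coefCM coefXn; congr (_ * _%:R); lia.
have nr : (n < r.+1)%N by rewrite /r; lia.
rewrite exprDn coef_sum (bigD1 (Ordinal nr)) //= big1 => [|i ir].
  by rewrite term eqxx mulr1 addr0.
rewrite term; case: eqP => [e2|_]; last by rewrite mulr0.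
by case/eqP: ir; apply: val_inj.
Qed.

Lemma sextuple_fact (k : nat) :
  ((6 * k)`! * k`! =
   12 ^ k * \prod_(j < k) ((6 * j + 1) * (6 * j + 5)) * (3 * k)`! * (2 * k)`!)%N.
Proof.
elim: k => [|k IHk]; first by rewrite big_ord0.
rewrite big_ord_recr /= expnS.
have -> : (6 * k.+1 = (6 * k).+2.+4)%N by lia.
have -> : (3 * k.+1 = (3 * k).+3)%N by lia.
have -> : (2 * k.+1 = (2 * k).+2)%N by lia.
rewrite !factS.
transitivity (((6 * k)`! * k`!) * (k.+1 * ((6 * k).+2.+4 * ((6 * k).+4.+1 * ((6 * k).+4 *
   ((6 * k).+3 * ((6 * k).+2 * (6 * k).+1)))))))%N; first by ring.
rewrite IHk; ring.
Qed.

(** Exhibits the [k]-th term of the sum as a Pochhammer quotient: the product on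
    the right is [36^k] times the rising factorials of [1/6] and [5/6]. *)
Lemma bin6_bin3 (k : nat) :
  ('C(6 * k, 3 * k) * 'C(3 * k, k) * (k`! * k`!) =
   12 ^ k * \prod_(j < k) ((6 * j + 1) * (6 * j + 5)))%N.
Proof.
have c6 : ('C(6 * k, 3 * k) * ((3 * k)`! * (3 * k)`!) = (6 * k)`!)%N.
  by rewrite -(@bin_fact (6 * k) (3 * k)); [congr (_ * (_ * _`!))%N; lia | lia].
have c3 : ('C(3 * k, k) * (k`! * (2 * k)`!) = (3 * k)`!)%N.
  by rewrite -(@bin_fact (3 * k) k); [congr (_ * (_ * _`!))%N; lia | lia].
have pos : (0 < (3 * k)`! * (2 * k)`!)%N by rewrite muln_gt0 !fact_gt0.
apply/eqP; rewrite -(eqn_pmul2r pos); apply/eqP.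
transitivity ('C(6 * k, 3 * k) * ((3 * k)`! * ('C(3 * k, k) * (k`! * (2 * k)`!))) * k`!)%N.
  by ring.
by rewrite c3 c6 sextuple_fact mulnA.
Qed.

(** * Gaussian integers *)

(** A name of its own, because pairs of integers already carry the componentwise
    product. *)
Definition gaussInt := (int * int)%type.

HB.instance Definition _ := GRing.Zmodule.on gaussInt.

Lemma gauss_addE (x y : gaussInt) : x + y = (x.1 + y.1, x.2 + y.2).
Proof. by []. Qed.

Definition gauss_mul (x y : gaussInt) : gaussInt :=
  (x.1 * y.1 - x.2 * y.2, x.1 * y.2 + x.2 * y.1).

Fact gauss_mulA : associative gauss_mul.
Proof. by move=> [a b] [c d] [e f]; rewrite /gauss_mul /=; congr (_, _); ring. Qed.

Fact gauss_mulC : commutative gauss_mul.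
Proof. by move=> [a b] [c d]; rewrite /gauss_mul /=; congr (_, _); ring. Qed.

Fact gauss_mul1 : left_id (1, 0) gauss_mul.
Proof. by move=> [a b]; rewrite /gauss_mul /=; congr (_, _); ring. Qed.

Fact gauss_mulDl : left_distributive gauss_mul +%R.
Proof. by move=> [a b] [c d] [e f]; rewrite !gauss_addE /gauss_mul /=; congr (_, _); ring. Qed.

Fact gauss_one_neq0 : (1, 0) != 0 :> gaussInt.
Proof. by []. Qed.

HB.instance Definition _ := GRing.Zmodule_isComNzRing.Build gaussInt
  gauss_mulA gauss_mulC gauss_mul1 gauss_mulDl gauss_one_neq0.

Definition gauss_i : gaussInt := (0, 1).

Definition gauss_conj (z : gaussInt) : gaussInt := (z.1, - z.2).

Definition gauss_norm (z : gaussInt) : int := z.1 ^+ 2 + z.2 ^+ 2.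

Lemma gauss_conjD x y : gauss_conj (x + y) = gauss_conj x + gauss_conj y.
Proof. by case: x y => [a b] [c d]; rewrite /gauss_conj /= opprD. Qed.

Lemma gauss_conjM x y : gauss_conj (x * y) = gauss_conj x * gauss_conj y.
Proof.
by case: x y => [a b] [c d]; congr (_, _) => /=; ring.
Qed.

Lemma gauss_conj0 : gauss_conj 0 = 0.
Proof. by []. Qed.

Lemma gauss_conj_sum (I : finType) (F : I -> gaussInt) :
  gauss_conj (\sum_i F i) = \sum_i gauss_conj (F i).
Proof. by apply: (big_morph gauss_conj gauss_conjD). Qed.

Lemma gauss_natE (n : nat) : n%:R = (n%:Z, 0) :> gaussInt.
Proof. by elim: n => // n IHn; rewrite -natr1 IHn; congr (_, _) => /=; lia. Qed.

Lemma gauss_intE (n : int) : n%:~R = (n, 0) :> gaussInt.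
Proof. by case: n => n; rewrite ?NegzE ?mulrNz -pmulrn gauss_natE. Qed.

Lemma gauss_mul_conj z : z * gauss_conj z = (gauss_norm z)%:~R.
Proof.
by rewrite gauss_intE; case: z => a b; congr (_, _); rewrite /gauss_norm /=; ring.
Qed.

Lemma gauss_int_mulI (n : int) (z : gaussInt) : n != 0 -> n%:~R * z = 0 -> z = 0.
Proof.
move=> n0; rewrite gauss_intE; case: z => a b; case=> /= /eqP + /eqP.
rewrite !mul0r subr0 addr0 !mulf_eq0 (negPf n0) /= => /eqP -> /eqP ->.
by [].
Qed.

(** Zero and the four units, as a list: statements about character values can
    then be settled by enumeration. *)
Definition quartic_values : seq gaussInt :=
  [:: 0; 1; gauss_i; -1; - gauss_i].

Section GaussEval.

Variables (S : comNzRingType) (i0 : S).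

Definition gauss_eval (z : gaussInt) : S := z.1%:~R + z.2%:~R * i0.

Lemma gauss_evalD x y : gauss_eval (x + y) = gauss_eval x + gauss_eval y.
Proof.
by case: x y => [a b] [c d]; rewrite /gauss_eval /= !rmorphD /=; ring.
Qed.

Lemma gauss_evalN x : gauss_eval (- x) = - gauss_eval x.
Proof. by case: x => [a b]; rewrite /gauss_eval /= !rmorphN /=; ring. Qed.

Lemma gauss_eval0 : gauss_eval 0 = 0.
Proof. by rewrite /gauss_eval /= mul0r addr0. Qed.

Lemma gauss_eval1 : gauss_eval 1 = 1.
Proof. by rewrite /gauss_eval /= mul0r addr0. Qed.

Lemma gauss_eval_i : gauss_eval gauss_i = i0.
Proof. by rewrite /gauss_eval /= mul1r add0r. Qed.

Lemma gauss_eval_sum (I : finType) (F : I -> gaussInt) :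
  gauss_eval (\sum_i F i) = \sum_i gauss_eval (F i).
Proof. exact: (big_morph gauss_eval gauss_evalD gauss_eval0). Qed.

Hypothesis i0_sqr : i0 * i0 = -1.

Lemma gauss_evalM x y : gauss_eval (x * y) = gauss_eval x * gauss_eval y.
Proof.
case: x y => [a b] [c d].
transitivity (a%:~R * c%:~R + (b%:~R * d%:~R) * (i0 * i0) +
   (a%:~R * d%:~R + b%:~R * c%:~R) * i0); last by rewrite /gauss_eval /=; ring.
rewrite i0_sqr /gauss_eval /= rmorphB rmorphD !rmorphM /=; ring.
Qed.

Lemma gauss_evalX x n : gauss_eval (x ^+ n) = gauss_eval x ^+ n.
Proof.
by elim: n => [|n IHn]; rewrite ?expr0 ?gauss_eval1 // !exprS gauss_evalM IHn.
Qed.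

End GaussEval.

Lemma quartic_valuesM x y : x \in quartic_values -> y \in quartic_values ->
  x * y \in quartic_values.
Proof.
have /allP H : all (fun x => all (fun y => x * y \in quartic_values)
  quartic_values) quartic_values by vm_compute.
by move=> /H /allP H1 /H1.
Qed.

(** The possible norms are prime to every odd [p], which makes the evaluation in
    ['F_p] injective on these values. *)
Lemma quartic_valuesB x y : x \in quartic_values -> y \in quartic_values ->
  x != y -> gauss_norm (x - y) \in [:: 1; 2; 4].
Proof.
have /allP H : all (fun x => all (fun y => (x != y) ==>
  (gauss_norm (x - y) \in [:: 1; 2; 4])) quartic_values) quartic_values by vm_compute.
by move=> /H /allP H1 /H1 /implyP.
Qed.

Lemma quartic_values_neq0 x : x \in quartic_values -> x != 0 ->
  [/\ x ^+ 4 = 1, x * gauss_conj x = 1 & x ^+ 2 \in [:: 1; -1]].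
Proof.
have /allP H : all (fun x => (x != 0) ==> [&& x ^+ 4 == 1, x * gauss_conj x == 1
   & x ^+ 2 \in [:: 1; -1]]) quartic_values by vm_compute.
by move=> /H /implyP H1 /H1 /and3P[/eqP ? /eqP].
Qed.

Lemma quartic_values_conj x : x \in quartic_values -> gauss_conj x = x ^+ 3.
Proof.
have /allP H : all (fun x => gauss_conj x == x ^+ 3) quartic_values by vm_compute.
by move=> /H /eqP.
Qed.

(** * The quartic Jacobi sum *)

(** Outside the fixed points of [s] every orbit has three elements, and [F] is
    constant on it. *)
Lemma cyclic3_sum (T : finType) (V : nmodType) (s : T -> T) (F : T -> V) :
    (forall t, s (s (s t)) = t) -> (forall t, F (s t) = F t) ->
  exists w, \sum_t F t = \sum_(t | s t == t) F t + w *+ 3.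
Proof.
move=> s3 Fs.
have sI : injective s by apply: (can_inj (g := fun t => s (s t))).
have orbits n (X : {set T}) : (#|X| <= n)%N ->
    {in X, forall t, s t \in X /\ s t != t} -> exists w, \sum_(t in X) F t = w *+ 3.
  elim: n X => [|n IHn] X cX sX.
    exists 0; rewrite mul0rn big1 // => t; move: cX.
    by rewrite leqn0 cards_eq0 => /eqP ->; rewrite inE.
  have [->|[t tX]] := set_0Vmem X; first by exists 0; rewrite mul0rn big_set0.
  have [stX st] := sX t tX; have [sstX sst] := sX _ stX.
  have ssnt : s (s t) != t by apply: contra st => /eqP e; rewrite -{2}[t]s3 e.
  pose X3 := X :\ t :\ s t :\ s (s t).
  have cX3 : (#|X3| <= n)%N.
    rewrite -ltnS (leq_trans _ cX) //.
    apply: proper_card; apply/properP; split; last by exists t; rewrite ?inE ?eqxx ?andbF.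
    by rewrite /X3 !(subset_trans (subD1set _ _)).
  have [x|w wE] := IHn X3 cX3.
    rewrite !inE => /and4P[xsst xst xt /sX[sx sxx]]; split=> //.
    have e3 : (s x == t) = (x == s (s t)) by rewrite -{1}[t]s3 (inj_eq sI).
    by rewrite sx e3 !(inj_eq sI) xsst xst xt.
  exists (F t + w); rewrite (big_setD1 t) //= (big_setD1 (s t)) ?inE ?st ?stX //=.
  rewrite (big_setD1 (s (s t))) ?inE ?sst ?ssnt ?sstX //= -/X3 wE !Fs.
  have F3 : F t *+ 3 = F t + (F t + F t) by [].
  by rewrite mulrnDl F3 !addrA.
pose X := [set t | s t != t].
have [t|w wE] := orbits _ X (leqnn _).
  by rewrite !inE (inj_eq sI) => st; rewrite st.
exists w; rewrite -wE (bigID (fun t => s t == t)) /=; congr (_ + _).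
by apply: eq_bigl => t; rewrite inE.
Qed.

Section QuarticCharacter.

Variables (p : nat) (i0 : 'F_p).
Hypothesis p_pr : prime p.
Hypothesis p_mod4 : (p %% 4 = 1)%N.
Hypothesis i0_sqr : i0 * i0 = -1.

Notation q := (p %/ 4)%N.
Notation ev := (gauss_eval i0).

Variable chi : 'F_p -> gaussInt.
Hypothesis quartic_char_values : forall x, chi x \in quartic_values.
Hypothesis quartic_char_eval : forall x, ev (chi x) = x ^+ q.

Notation rho x := (chi x ^+ 2).

(** Consequently the two hypotheses on [chi] characterise it, and an identity
    between its values may be checked in ['F_p]. *)
Lemma gauss_eval_values_inj : {in quartic_values &, injective ev}.
Proof.
move=> x y xv yv e; apply/eqP/negPn/negP => xy.
have := quartic_valuesB xv yv xy; set n := gauss_norm _ => nv.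
have : n%:~R = 0 :> 'F_p.
  transitivity (ev (n%:~R)); first by rewrite gauss_intE /gauss_eval /= mul0r addr0.
  by rewrite -gauss_mul_conj gauss_evalM // gauss_evalD gauss_evalN e subrr mul0r.
have p1 := prime_gt1 p_pr.
by apply/eqP; move: nv; rewrite !inE => /or3P[]/eqP ->; rewrite Fp_nat_neq0 //; lia.
Qed.

Lemma quartic_charM x y : chi (x * y) = chi x * chi y.
Proof.
apply: gauss_eval_values_inj; rewrite ?quartic_valuesM ?quartic_char_values //.
by rewrite gauss_evalM // !quartic_char_eval exprMn.
Qed.

Lemma quartic_char0 : chi 0 = 0.
Proof.
apply: gauss_eval_values_inj; rewrite ?quartic_char_values //.
rewrite quartic_char_eval gauss_eval0 expr0n eqn0Ngt; case: ltnP => //.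
by have := prime_gt1 p_pr; lia.
Qed.

Lemma quartic_char1 : chi 1 = 1.
Proof.
apply: gauss_eval_values_inj; rewrite ?quartic_char_values //.
by rewrite quartic_char_eval gauss_eval1 expr1n.
Qed.

Lemma quartic_char_neq0 x : x != 0 -> chi x != 0.
Proof.
move=> x0; apply/eqP => /(congr1 ev); rewrite quartic_char_eval gauss_eval0.
by move/eqP; rewrite expf_eq0 (negPf x0) andbF.
Qed.

Lemma quartic_charX4 x : x != 0 -> chi x ^+ 4 = 1.
Proof.
move=> x0; have [] := quartic_values_neq0 (quartic_char_values x) => //.
exact: quartic_char_neq0.
Qed.

Lemma quartic_char_conj x : x != 0 -> chi x * gauss_conj (chi x) = 1.
Proof.
move=> x0; have [] := quartic_values_neq0 (quartic_char_values x) => //.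
exact: quartic_char_neq0.
Qed.

Lemma quadratic_char_values x : x != 0 -> rho x \in [:: 1; -1].
Proof.
move=> x0; have [] := quartic_values_neq0 (quartic_char_values x) => //.
exact: quartic_char_neq0.
Qed.

Lemma quartic_char_surj : exists g, chi g = gauss_i.
Proof.
have p1 := prime_gt1 p_pr.
have e4 : (q * 4 = p.-1)%N by lia.
have [g gp] := Fp_primitive_root p_pr.
have i0n : i0 != 0.
  by apply/eqP => e; move/eqP: i0_sqr; rewrite e mul0r eq_sym oppr_eq0 oner_eq0.
have [k kE] := Fp_exp_generator p_pr gp i0n.
have : g ^+ (k * 4) == 1.
  rewrite exprM -kE; have -> : i0 ^+ 4 = (i0 * i0) * (i0 * i0) by ring.
  by rewrite i0_sqr mulrNN mulr1.
rewrite -(prim_order_dvd gp) -e4 dvdn_pmul2r // => /dvdnP[l lE].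
exists (g ^+ l); apply: gauss_eval_values_inj; rewrite ?quartic_char_values //.
by rewrite quartic_char_eval gauss_eval_i -exprM -lE -kE.
Qed.

Lemma mul_neq1_eq0 (c S : gaussInt) : gauss_norm (c - 1) != 0 -> c * S = S -> S = 0.
Proof.
move=> n0 e; apply: (gauss_int_mulI n0); rewrite -gauss_mul_conj mulrAC mulrBl e.
by rewrite mul1r subrr mul0r.
Qed.

(** Multiplying the argument by some [g] with [chi g = i] multiplies the sum by
    [i^j], which differs from [1]. *)
Lemma quartic_char_sum j : (0 < j < 4)%N -> \sum_x chi x ^+ j = 0.
Proof.
move=> j4; have [g gE] := quartic_char_surj.
have g0 : g != 0 by apply/eqP => e; move: gE; rewrite e quartic_char0.
apply: (@mul_neq1_eq0 (gauss_i ^+ j)).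
  by case: j j4 => [|[|[|[|j]]]].
rewrite mulr_sumr [RHS](reindex_inj (mulfI g0)) /=.
by apply: eq_bigr => x _; rewrite quartic_charM gE exprMn.
Qed.

Lemma quadratic_charE z : rho z = 1 -> exists y, z = y ^+ 2.
Proof.
move=> z1; have p1 := prime_gt1 p_pr.
have z0 : z != 0 by apply/eqP => e; move: z1; rewrite e quartic_char0 expr0n.
have [g gp] := Fp_primitive_root p_pr; have [k kE] := Fp_exp_generator p_pr gp z0.
have : g ^+ (k * (q * 2)) == 1.
  by rewrite exprM -kE exprM -quartic_char_eval -gauss_evalX // z1 gauss_eval1.
have e4 : (p.-1 = 2 * (q * 2))%N by lia.
rewrite -(prim_order_dvd gp) e4 dvdn_pmul2r; last by lia.
by case/dvdnP => l lE; exists (g ^+ l); rewrite kE lE exprM.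
Qed.

(** The factor [1 + rho z] is the number of square roots of [z]. *)
Lemma sum_over_squares (F : 'F_p -> gaussInt) :
  \sum_y F (y ^+ 2) = \sum_z F z * (1 + rho z).
Proof.
rewrite (partition_big (fun y => y ^+ 2) xpredT) //; apply: eq_bigr => z _.
transitivity (\sum_(y in [pred y | y ^+ 2 == z]) F z).
  by apply: eq_bigr => y /eqP ->.
rewrite sumr_const -mulr_natr; congr (_ * _).
have [->|z0] := eqVneq z 0.
  rewrite quartic_char0 expr0n addr0 (@eq_card1 _ (0 : 'F_p)) // => y.
  by rewrite !inE expf_eq0.
have [/existsP[y0 /eqP y0E]|nsq] := boolP [exists y : 'F_p, z == y ^+ 2].
  have y00 : y0 != 0 by apply: contra_neq z0 => e; rewrite y0E e expr0n.
  have p1 := prime_gt1 p_pr.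
  have y0n : y0 != - y0.
    rewrite -addr_eq0 -mulr2n -mulr_natr mulf_neq0 //.
    by rewrite Fp_nat_neq0 //; lia.
  have -> : rho z = 1.
    by rewrite y0E [y0 ^+ 2]expr2 quartic_charM -(quartic_charX4 y00); ring.
  rewrite y0E.
  rewrite (@eq_card _ _ (pred2 y0 (- y0))) => [|y]; first by rewrite card2 y0n.
  by rewrite !inE eqf_sqr.
rewrite eq_card0 => [|y]; last first.
  rewrite !inE; apply: contraNF nsq => /eqP e.
  by apply/existsP; exists y; rewrite e.
have := quadratic_char_values z0; rewrite !inE => /orP[]/eqP e.
  have [y yE] := quadratic_charE e; case/existsP: nsq; exists y; exact/eqP.
by rewrite e subrr.
Qed.

Definition quartic_jacobi_sum : gaussInt := \sum_z chi z * rho (1 - z).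
Notation K := quartic_jacobi_sum.

Lemma quartic_char_sum1 : \sum_x chi x = 0.
Proof. exact: (@quartic_char_sum 1 isT). Qed.

Lemma quadratic_char_inv w : w != 0 -> rho w^-1 = rho w.
Proof.
move=> w0; have e1 : chi w^-1 * chi w = 1 by rewrite -quartic_charM mulVf // quartic_char1.
transitivity (rho w^-1 * chi w ^+ 4); first by rewrite quartic_charX4 // mulr1.
transitivity ((chi w^-1 * chi w) ^+ 2 * rho w); first by ring.
by rewrite e1 expr1n mul1r.
Qed.

Lemma quadratic_charM x y : rho (x * y) = rho x * rho y.
Proof. by rewrite quartic_charM exprMn. Qed.

Lemma quadratic_char_sqr w : w != 0 -> rho w * rho w = 1.
Proof. by move=> w0; rewrite -exprD quartic_charX4. Qed.

Lemma sum_affine (c d : 'F_p) (F : 'F_p -> gaussInt) : c != 0 ->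
  \sum_x F (c * x + d) = \sum_x F x.
Proof.
move=> c0; rewrite [RHS](reindex_inj (h := fun x => c * x + d)) //.
by move=> x y /addIr /(mulfI c0).
Qed.

(** With [y = 1 - w] the argument is [(1 - t + t w) w]; replacing [w] by its
    inverse turns this into a linear polynomial divided by a square. *)
Lemma quadratic_correlation t : t != 0 ->
  \sum_(y | y != 0) rho ((1 - t * y) * (1 - y)) =
  (if t == 1 then p%:R else 0) - 1 - rho t.
Proof.
move=> t0.
have -> : \sum_(y | y != 0) rho ((1 - t * y) * (1 - y)) =
    \sum_y rho ((1 - t * y) * (1 - y)) - 1.
  rewrite [in RHS](bigD1 0) //= mulr0 subr0 mulr1 quartic_char1 expr1n; ring.
have -> : \sum_y rho ((1 - t * y) * (1 - y)) =
    \sum_w rho ((1 - t + t * w) * w).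
  rewrite -[RHS](@sum_affine (-1) 1) ?oppr_eq0 ?oner_eq0 //.
  by apply: eq_bigr => y _; congr (rho (_ * _)); ring.
have -> : \sum_w rho ((1 - t + t * w) * w) = \sum_(w | w != 0) rho ((1 - t) * w + t).
  rewrite (bigD1 0) //= !mulr0 quartic_char0 expr0n add0r.
  rewrite (reindex_inj invr_inj) /=; apply: eq_big => [w|w]; first by rewrite invr_eq0.
  rewrite invr_eq0 => w0.
  have -> : (1 - t + t / w) / w = ((1 - t) * w + t) * (w^-1 * w^-1) by field.
  by rewrite quadratic_charM quadratic_charM quadratic_char_inv // quadratic_char_sqr // mulr1.
have -> : \sum_(w | w != 0) rho ((1 - t) * w + t) = \sum_w rho ((1 - t) * w + t) - rho t.
  by rewrite [in RHS](bigD1 0) //= mulr0 add0r; ring.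
have [->|t1] := eqVneq t 1.
  rewrite (eq_bigr (fun=> 1)) => [|w _]; last by rewrite subrr mul0r add0r quartic_char1 expr1n.
  by rewrite sumr_const card_Fp //; ring.
rewrite (@sum_affine (1 - t) t (fun x => rho x)) ?subr_eq0 1?eq_sym //.
by rewrite (@quartic_char_sum 2) //; ring.
Qed.

Lemma quadratic_char_conj x : gauss_conj (rho x) = rho x.
Proof.
have [->|x0] := eqVneq x 0; first by rewrite quartic_char0 expr0n.
by have := quadratic_char_values x0; rewrite !inE => /orP[]/eqP ->.
Qed.

(** In the product of the sum over [x] with the conjugate sum over [y], the
    substitution [x = t y] separates [chi t] from a correlation of the quadratic
    character. *)
Lemma quartic_jacobi_sum_norm : K * gauss_conj K = p%:R.
Proof.
rewrite {2}/K gauss_conj_sum mulr_sumr.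
transitivity (\sum_(y | y != 0) \sum_t chi t * rho ((1 - t * y) * (1 - y))).
  rewrite (bigD1 0) //= quartic_char0 gauss_conjM gauss_conj0 mul0r mulr0 add0r.
  apply: eq_bigr => y y0; rewrite /K mulr_suml (reindex_inj (mulIf y0)) /=.
  apply: eq_bigr => t _.
  rewrite gauss_conjM quadratic_char_conj quartic_charM quadratic_charM.
  transitivity (chi t * rho (1 - t * y) * rho (1 - y) * (chi y * gauss_conj (chi y))).
    by ring.
  by rewrite quartic_char_conj //; ring.
rewrite exchange_big /=.
transitivity (\sum_t ((if t == 1 then p%:R else 0) - chi t - chi t ^+ 3)).
  apply: eq_bigr => t _; rewrite -mulr_sumr.
  have [->|t0] := eqVneq t 0.
    by rewrite quartic_char0 eq_sym oner_eq0; ring.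
  rewrite quadratic_correlation //; case: eqP => [->|_]; last by ring.
  by rewrite quartic_char1; ring.
rewrite !sumrB quartic_char_sum1 (@quartic_char_sum 3) // -big_mkcond /= big_pred1_eq; ring.
Qed.

(** Expanding [(chi z - 1) (rho (1 - z) - 1)] and summing over [z] leaves only
    [K] and the number of terms. For [z] other than [0] and [1], [1 - i] divides
    the first factor and [2] the second. *)
Lemma quartic_jacobi_sum_mod4 : exists w, K + p%:R = (1 - gauss_i) * 2 * w.
Proof.
have -> : K + p%:R = \sum_z (chi z - 1) * (rho (1 - z) - 1).
  transitivity (\sum_z (chi z * rho (1 - z) - chi z - rho (1 - z) + 1)); last first.
    by apply: eq_bigr => z _; ring.
  rewrite big_split !sumrB /= quartic_char_sum1 sumr_const card_Fp //.
  have -> : \sum_z rho (1 - z) = \sum_z rho z.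
    rewrite -[RHS](@sum_affine (-1) 1) ?oppr_eq0 ?oner_eq0 //.
    by apply: eq_bigr => y _; congr (rho _); ring.
  by rewrite (@quartic_char_sum 2) // /K; ring.
apply: (big_ind (fun S => exists w, S = (1 - gauss_i) * 2 * w)).
- by exists 0; rewrite mulr0.
- by move=> _ _ [u ->] [v ->]; exists (u + v); ring.
move=> z _.
have [->|z0] := eqVneq z 0.
  by exists 0; rewrite subr0 quartic_char1 expr1n subrr !mulr0.
have [->|z1] := eqVneq z 1; first by exists 0; rewrite quartic_char1 subrr mul0r mulr0.
have z1' : 1 - z != 0 by rewrite subr_eq0 eq_sym.
have [u ->] : exists u, rho (1 - z) - 1 = 2 * u.
  have := quadratic_char_values z1'; rewrite !inE => /orP[]/eqP ->.
    by exists 0; rewrite subrr mulr0.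
  by exists (-1).
have [v ->] : exists v, chi z - 1 = (1 - gauss_i) * v.
  have := quartic_char_values z; rewrite !inE (negPf (quartic_char_neq0 z0)) /=.
  case/or4P => /eqP ->.
  - by exists 0; rewrite subrr mulr0.
  - by exists (-1); ring.
  - by exists (- 1 - gauss_i).
  - by exists (- gauss_i).
by exists (u * v); ring.
Qed.

(** By homogeneity, the Jacobi sum of three copies of [chi] is [J * K], where [J]
    is that of two copies. Completing the square, [4 x (1 - x) = 1 - (1 - 2 x)^2]
    gives [chi 4 * J = K]. *)
Lemma quartic_jacobi_sum_sqr :
  chi 4 * (\sum_x \sum_y chi x * chi y * chi (1 - x - y)) = K ^+ 2.
Proof.
have p1 := prime_gt1 p_pr.
pose J := \sum_x chi x * chi (1 - x).
have JK : chi 4 * J = K.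
  rewrite /J mulr_sumr.
  have n2 : (2 : 'F_p) != 0 by rewrite Fp_nat_neq0 //; lia.
  transitivity (\sum_y chi (1 - y ^+ 2)).
    rewrite -[RHS](@sum_affine (-2) 1) ?oppr_eq0 //; apply: eq_bigr => x _.
    by rewrite -!quartic_charM; congr chi; ring.
  rewrite (sum_over_squares (fun z => chi (1 - z))).
  transitivity (\sum_z chi (1 - z) + \sum_z chi (1 - z) * rho z).
    by rewrite -big_split; apply: eq_bigr => z _ /=; ring.
  rewrite -[X in X + _](@sum_affine (-1) 1) ?oppr_eq0 ?oner_eq0 //.
  rewrite -[X in _ + X](@sum_affine (-1) 1) ?oppr_eq0 ?oner_eq0 //.
  have e (z : 'F_p) : 1 - (-1 * z + 1) = z by ring.
  rewrite (eq_bigr chi) => [|z _]; last by rewrite e.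
  rewrite quartic_char_sum1 add0r; apply: eq_bigr => z _; rewrite e; congr (_ * rho _); ring.
suff -> : \sum_x \sum_y chi x * chi y * chi (1 - x - y) = J * K.
  by rewrite mulrA JK expr2.
rewrite /K mulr_sumr; apply: eq_bigr => x _.
have [x1|x1] := eqVneq (1 - x) 0.
  rewrite x1 quartic_char0 expr0n !mulr0.
  transitivity (chi x * chi (-1) * \sum_y chi y ^+ 2); last first.
    by rewrite (@quartic_char_sum 2) ?mulr0.
  rewrite mulr_sumr; apply: eq_bigr => y _.
  have -> : 0 - y = -1 * y by ring.
  by rewrite quartic_charM; ring.
rewrite (reindex_inj (mulfI x1)) /= /J mulr_suml.
apply: eq_bigr => y _.
have -> : 1 - x - (1 - x) * y = (1 - x) * (1 - y) by ring.
by rewrite !quartic_charM; ring.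
Qed.

(** Gauss's congruence for the cube of a quartic Gauss sum: the cyclic group of
    order three permutes the triples of sum [1], and fixes the one with equal
    entries. *)
Lemma quartic_jacobi_sum_mod3 : (3 %| p)%N = false ->
  exists w, K ^+ 2 = chi 4 * chi 3 + w *+ 3.
Proof.
move=> p3.
have n3 : (3 : 'F_p) != 0.
  have p1 := prime_gt1 p_pr; rewrite Fp_nat_neq0 //=; lia.
rewrite -quartic_jacobi_sum_sqr pair_big /=.
pose F (t : 'F_p * 'F_p) := chi t.1 * chi t.2 * chi (1 - t.1 - t.2).
have [|t|w wE] := @cyclic3_sum _ _ (fun t : 'F_p * 'F_p => (t.2, 1 - t.1 - t.2)) F.
- by case=> x y /=; congr (_, _); ring.
- case: t => x y; rewrite /F /=.
  have -> : 1 - y - (1 - x - y) = x by ring.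
  by ring.
exists (chi 4 * w); rewrite -[X in chi 4 * X]/(\sum_t F t) wE mulrDr mulrnAr.
congr (_ * _ + _).
rewrite (big_pred1 (3^-1, 3^-1)) => [|[x y]]; last first.
  rewrite /= !xpair_eqE; apply/andP/andP => -[/eqP ? /eqP e].
    subst x; have {}e : y = 3^-1.
      by apply: (mulfI n3); rewrite divff //; transitivity (2 * y + (1 - y - y)); [rewrite e; ring | ring].
    by rewrite e.
  subst x; rewrite e; split=> //; apply/eqP; field; exact: n3.
rewrite /F /=; have -> : 1 - 3^-1 - 3^-1 = 3^-1 :> 'F_p by field; exact: n3.
have e1 : chi 3^-1 * chi 3 = 1 by rewrite -quartic_charM mulVf // quartic_char1.
transitivity (chi 3^-1 * chi 3^-1 * chi 3^-1 * chi 3 ^+ 4).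
  by rewrite quartic_charX4 // mulr1.
transitivity ((chi 3^-1 * chi 3) ^+ 3 * chi 3); first by ring.
by rewrite e1 expr1n mul1r.
Qed.

(** This is the quadratic character of [2]: as [i0^2 = -1], the number [4] is the
    opposite of the fourth power of [1 + i0]. *)
Lemma quartic_char4 : chi 4 = (-1) ^+ q.
Proof.
have p1 := prime_gt1 p_pr.
apply: gauss_eval_values_inj; first exact: quartic_char_values.
  by rewrite -signr_odd; case: (odd q).
rewrite quartic_char_eval gauss_evalX // gauss_evalN gauss_eval1.
have n1 : 1 + i0 != 0.
  rewrite addrC addr_eq0; apply/eqP => e; move: i0_sqr; rewrite e mulrNN mulr1.
  move/eqP; rewrite -addr_eq0 -[1 + 1]/(2%:R); apply/negP.
  by rewrite Fp_nat_neq0 //; lia.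
have -> : 4 = (i0 * i0) * (1 + i0) ^+ 4 :> 'F_p.
  transitivity ((i0 * i0) * (1 + 2 * i0 + i0 * i0) ^+ 2); last by ring.
  rewrite i0_sqr; transitivity (- 4 * (i0 * i0)); last by ring.
  by rewrite i0_sqr; ring.
rewrite exprMn i0_sqr -exprM; have -> : (4 * q = p.-1)%N by lia.
by rewrite Fp_fermat1 // mulr1.
Qed.

End QuarticCharacter.

Section QuarticCharacterExistence.

Variables (p : nat) (i0 : 'F_p).
Hypothesis p_pr : prime p.
Hypothesis p_mod4 : (p %% 4 = 1)%N.
Hypothesis i0_sqr : i0 * i0 = -1.

Notation q := (p %/ 4)%N.
Notation ev := (gauss_eval i0).

Definition quartic_char (x : 'F_p) : gaussInt :=
  let y := x ^+ q in
  if y == 1 then 1 else if y == i0 then gauss_i else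
  if y == -1 then -1 else if y == - i0 then - gauss_i else 0.

Notation chi := quartic_char.

Lemma quartic_char_values x : chi x \in quartic_values.
Proof. by rewrite /chi; do 4![case: ifP => // _]. Qed.

Lemma quartic_char_eval x : ev (chi x) = x ^+ q.
Proof.
have p1 := prime_gt1 p_pr.
rewrite /chi; case: eqP => [->|y1]; first by rewrite gauss_eval1.
case: eqP => [->|yi]; first by rewrite gauss_eval_i.
case: eqP => [->|y1']; first by rewrite gauss_evalN gauss_eval1.
case: eqP => [->|yi']; first by rewrite gauss_evalN gauss_eval_i.
rewrite gauss_eval0; have [->|x0] := eqVneq x 0; first by rewrite expr0n eqn0Ngt; case: ltnP => //; lia.
have : (x ^+ q - 1) * (x ^+ q + 1) * ((x ^+ q - i0) * (x ^+ q + i0)) = 0.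
  transitivity (((x ^+ q) ^+ 2 - 1) * ((x ^+ q) ^+ 2 - i0 * i0)); first by ring.
  rewrite i0_sqr opprK; transitivity ((x ^+ q) ^+ 4 - 1); first by ring.
  have e : (q * 4 = p.-1)%N by lia.
  by rewrite -exprM e Fp_fermat1 // subrr.
move/eqP; rewrite !mulf_eq0 !subr_eq0 !addr_eq0.
by case/orP => /orP[]/eqP.
Qed.

End QuarticCharacterExistence.

(** * First-order calculus modulo the square of a prime *)

(** The ring [R] plays the role of [Z/p^2]: only the square-zero ideal [p R] and
    the residue field ['F_p] matter. *)
Section SquareZeroExtension.

Variables (p : nat) (R : comUnitRingType) (red : {rmorphism R -> 'F_p}).
Hypothesis p_pr : prime p.
Hypothesis sqr_p : p%:R * p%:R = 0 :> R.
Hypothesis red_ker : forall x, red x = 0 -> exists c, x = p%:R * c.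

Notation H := (harmonic p).

Definition lift (x : 'F_p) : R := (x : nat)%:R.

Lemma red_lift x : red (lift x) = x.
Proof. by rewrite rmorph_nat natr_Zp. Qed.

Lemma p_mul_eq (x y : R) : red x = red y -> p%:R * x = p%:R * y.
Proof.
move=> xy; have [|c] := @red_ker (x - y); first by rewrite rmorphB xy subrr.
move/eqP; rewrite subr_eq => /eqP ->.
by rewrite mulrDr mulrA sqr_p mul0r add0r.
Qed.

(** The product of [p] with an element only depends on the residue of that
    element, so first-order terms are indexed by ['F_p], where their algebra can
    be done in a field. *)
Definition delta (x : 'F_p) : R := p%:R * lift x.

Lemma p_mulE (x : R) : p%:R * x = delta (red x).
Proof. by apply: p_mul_eq; rewrite red_lift. Qed.

Lemma deltaD x y : delta (x + y) = delta x + delta y.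
Proof. by rewrite /delta -mulrDr; apply: p_mul_eq; rewrite rmorphD !red_lift. Qed.

Lemma delta0 : delta 0 = 0.
Proof. by rewrite -[0 in LHS](rmorph0 red) -p_mulE mulr0. Qed.

Lemma deltaN x : delta (- x) = - delta x.
Proof. by apply/eqP; rewrite -addr_eq0 -deltaD addNr delta0. Qed.

Lemma mul_delta x y : x * delta y = delta (red x * y).
Proof. by rewrite /delta mulrCA; apply: p_mul_eq; rewrite rmorphM !red_lift. Qed.

Lemma red_delta x : red (delta x) = 0.
Proof. by rewrite rmorphM rmorph_nat Fp_p_eq0 ?mul0r. Qed.

Lemma delta_mul x y : delta x * delta y = 0.
Proof. by rewrite mul_delta red_delta mul0r delta0. Qed.

(** A group morphism from the additive group of ['F_p] to the units of [R]. *)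
Definition oneunit (x : 'F_p) : R := 1 + delta x.
Notation E := oneunit.

Lemma p_mulE1 : p%:R = delta 1.
Proof. by rewrite -[LHS]mulr1 p_mulE rmorph1. Qed.

Lemma oneunit0 : E 0 = 1.
Proof. by rewrite /E delta0 addr0. Qed.

Lemma oneunitD x y : E (x + y) = E x * E y.
Proof.
by rewrite /E deltaD mulrDl mul1r mulrDr mulr1 delta_mul addr0 addrA addrAC.
Qed.

Lemma oneunit_unit x : E x \is a GRing.unit.
Proof. by apply/unitrPr; exists (E (- x)); rewrite -oneunitD subrr oneunit0. Qed.

Lemma oneunitX x n : E x ^+ n = E (n%:R * x).
Proof.
elim: n => [|n IHn]; first by rewrite mul0r oneunit0.
by rewrite exprS IHn -oneunitD -natr1 mulrDl mul1r addrC.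
Qed.

Lemma red_eq1 x : red x = 1 -> exists c, x = E c.
Proof.
move=> x1; have [|c] := @red_ker (x - 1); first by rewrite rmorphB x1 rmorph1 subrr.
by rewrite p_mulE => e; exists (red c); rewrite /E -e addrC subrK.
Qed.

Lemma unitRE x : (x \is a GRing.unit) = (red x != 0).
Proof.
apply/idP/idP => [xu|x0]; first by rewrite -unitfE rmorph_unit.
have [|c xc] := @red_eq1 (x ^+ p.-1); first by rewrite rmorphXn /= Fp_fermat1.
have := oneunit_unit c; rewrite -xc.
have -> : p.-1 = p.-2.+1 by have := prime_gt1 p_pr; lia.
by rewrite exprS unitrM => /andP[].
Qed.

Lemma nat_unit (n : nat) : ~~ (p %| n)%N -> n%:R \is a @GRing.unit R.
Proof. by rewrite unitRE rmorph_nat Fp_nat_eq0. Qed.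

Lemma fact_unit n : (n < p)%N -> n`!%:R \is a @GRing.unit R.
Proof.
elim: n => [|n IHn] np; first by rewrite fact0 unitr1.
by rewrite factS natrM unitrM IHn 1?ltnW // nat_unit // gtnNdvd.
Qed.

Lemma addp_unit (u y : R) : red u != 0 -> u + p%:R * y = u * E (red y / red u).
Proof.
move=> u0; rewrite /E mulrDr mulr1 mul_delta p_mulE; congr (_ + delta _).
by rewrite mulrC divfK.
Qed.

Lemma prod_addp n (u : nat -> R) (y : R) :
    (forall i, (i < n)%N -> red (u i) != 0) ->
  \prod_(i < n) (u i + p%:R * y) =
  (\prod_(i < n) u i) * E (red y * \sum_(i < n) (red (u i))^-1).
Proof.
elim: n => [|n IHn] u0; first by rewrite !big_ord0 mulr0 oneunit0 mulr1.
rewrite !big_ord_recr /= IHn => [|i /ltnW]; last exact: u0.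
rewrite addp_unit ?u0 // [red y * (_ + _)]mulrDr oneunitD; ring.
Qed.

Notation w := (p.-1`!%:R : R).

(** Wilson's theorem with its first-order term, from
    [p - k = - k (1 - p / k)]. *)
Lemma fact_compl n : (n < p)%N ->
  (p.-1 - n)`!%:R * n`!%:R = (-1) ^+ n * w * E (H n).
Proof.
elim: n => [|n IHn] np; first by rewrite subn0 harmonic0 oneunit0 fact0 expr0; ring.
have n0 : n.+1%:R != 0 :> 'F_p by rewrite Fp_nat_neq0.
have := IHn (ltnW np).
have -> : (p.-1 - n = (p.-1 - n.+1).+1)%N by lia.
rewrite factS natrM harmonicS oneunitD.
have -> : ((p.-1 - n.+1).+1%:R = - (n.+1%:R * E (- n.+1%:R^-1)) :> R).
  have -> : ((p.-1 - n.+1).+1 = p - n.+1)%N by lia.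
  rewrite natrB 1?ltnW // /E mulrDr mul_delta rmorph_nat mulrN divff //.
  by rewrite deltaN -p_mulE1; ring.
rewrite !mulNr => e.
have u : n.+1%:R * E (- n.+1%:R^-1) \is a @GRing.unit R.
  by rewrite unitrM oneunit_unit nat_unit // gtnNdvd.
apply: (mulrI u); rewrite exprS.
have E1 : E n.+1%:R^-1 * E (- n.+1%:R^-1) = 1 by rewrite -oneunitD subrr oneunit0.
have -> : n.+1%:R * E (- n.+1%:R^-1) * ((p.-1 - n.+1)`!%:R * n.+1`!%:R) =
  - n.+1%:R * (- (n.+1%:R * E (- n.+1%:R^-1) * (p.-1 - n.+1)`!%:R * n`!%:R)).
  by rewrite factS natrM; ring.
rewrite e.
transitivity (- n.+1%:R * ((-1) ^+ n * w * E (H n)) *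
   (E n.+1%:R^-1 * E (- n.+1%:R^-1))); first by rewrite E1 mulr1.
ring.
Qed.

(** * Duplication and triplication of factorials *)

Lemma double_fact (n : nat) :
  ((n.*2)`! = 2 ^ n * n`! * \prod_(i < n) (i.*2).+1)%N.
Proof.
elim: n => [|n IHn]; first by rewrite big_ord0.
rewrite doubleS !factS IHn big_ord_recr /= expnS -doubleS -!muln2; ring.
Qed.

Lemma triple_fact (n : nat) :
  ((3 * n)`! = 3 ^ n * n`! * \prod_(i < n) ((3 * i).+1 * (3 * i).+2))%N.
Proof.
elim: n => [|n IHn]; first by rewrite big_ord0.
have -> : (3 * n.+1 = (3 * n).+3)%N by lia.
rewrite !factS IHn big_ord_recr /= expnS; ring.
Qed.

Lemma prod_fact_shift (c n : nat) :
  (c`! * \prod_(i < n) (i + c).+1 = (c + n)`!)%N.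
Proof.
elim: n => [|n IHn]; first by rewrite big_ord0 addn0 muln1.
by rewrite big_ord_recr /= mulnA IHn addnS factS mulnC addnC.
Qed.

Lemma red_nat_neq0 (n : nat) : (0 < n < p)%N -> red n%:R != 0.
Proof. by move=> np; rewrite rmorph_nat Fp_nat_neq0. Qed.

Lemma prod_nat_addp (c n : nat) (y : R) : (c + n < p)%N ->
  c`!%:R * \prod_(i < n) ((i + c).+1%:R + p%:R * y) =
  (c + n)`!%:R * E (red y * (H (c + n) - H c)).
Proof.
move=> cnp.
rewrite (@prod_addp n (fun i => (i + c).+1%:R)) => [|i i_n]; last first.
  by apply: red_nat_neq0; lia.
rewrite mulrA -prod_fact_shift natrM natr_prod harmonicD.
by congr (_ * E (_ * _)); apply: eq_bigr => i _; rewrite rmorph_nat.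
Qed.

(** The odd numbers below [2 n] are the [2 (i + h + 1) - p] for [i < n], where
    [h = (p - 1)/2]. To first order, their product is therefore a ratio of
    factorials, which [fact_compl] brings below [h]. *)
Lemma central_binomial (n : nat) : odd p -> (n <= p./2)%N ->
  'C(n.*2, n)%:R =
  4 ^+ n * (-1) ^+ n * 'C(p./2, n)%:R * E ((H (p./2 - n) - H p./2) / 2).
Proof.
move=> op; set h := p./2 => nh.
have p1 := prime_gt1 p_pr.
have p2 : p = h.*2.+1 by rewrite /h; lia.
have u2 : (2 : R) \is a GRing.unit by rewrite nat_unit // gtnNdvd //; lia.
have f2 : (2 : 'F_p) != 0 by rewrite Fp_nat_neq0 //; lia.
have hf : (n`! * (h - n)`! * 'C(h, n) = h`!)%N by rewrite mulnC bin_fact.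
have nf : ('C(n.*2, n) * n`! * n`! = (n.*2)`!)%N.
  by rewrite -(@bin_fact n.*2 n) -?mulnA; [congr (_ * (_ * _`!))%N; lia | lia].
have odds : h`!%:R * (\prod_(i < n) (i.*2).+1)%:R =
    2 ^+ n * (h + n)`!%:R * E (- (H (h + n) - H h) / 2) :> R.
  have -> : - (H (h + n) - H h) / 2 = red (- 2^-1) * (H (h + n) - H h).
    by rewrite rmorphN rmorphV //= rmorph_nat; ring.
  rewrite -mulrA -prod_nat_addp; last by lia.
  have -> : 2 ^+ n = \prod_(i < n) (2 : R) by rewrite prodr_const card_ord.
  rewrite mulrCA; congr (_ * _); rewrite natr_prod -big_split /=.
  apply: eq_bigr => i _.
  rewrite mulrDr mulrN mulrN mulrCA divrr // mulr1.
  have e : ((i.*2).+1 + p = 2 * (i + h).+1)%N by lia.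
  by apply/eqP; rewrite eq_sym subr_eq -natrM -natrD e.
have half x : x / 2 + x / 2 = x :> 'F_p by rewrite -mulr2n -(mulr_natr (x / 2)) divfK.
set E2 := E (_ / 2).
have e12 : E (- (H (h + n) - H h) / 2) * E (H (h - n)) = E2 * E (H h).
  have <- : H (p.-1 - (h - n)) = H (h + n) by congr harmonic; lia.
  rewrite harmonic_compl //; last by lia.
  rewrite -!oneunitD; congr E.
  by rewrite -[X in _ + X]half -[X in _ = _ + X]half; ring.
have c1 := @fact_compl (h - n); have c2 := @fact_compl h.
have {}c1 : (h + n)`!%:R * (h - n)`!%:R = (-1) ^+ (h - n) * w * E (H (h - n)).
  by rewrite -c1; [congr (_`!%:R * _); lia | lia].
have {}c2 : h`!%:R * h`!%:R = (-1) ^+ h * w * E (H h).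
  by rewrite -c2; [congr (_`!%:R * _); lia | lia].
have U m : (m < p)%N -> m`!%:R \is a @GRing.unit R := @fact_unit m.
have c3 : 'C(n.*2, n)%:R * n`!%:R = 2 ^+ n * (\prod_(i < n) (i.*2).+1)%:R :> R.
  apply: (mulIr (U n _)); first by lia.
  by rewrite -!natrM nf double_fact natrM natrM natrX; ring.
have Uall : n`!%:R * h`!%:R * (h - n)`!%:R * E (H h) \is a GRing.unit.
  by rewrite !unitrM !U ?oneunit_unit //; lia.
have sqs m : (-1) ^+ m * (-1) ^+ m = 1 :> R by rewrite -exprMn mulrNN mulr1 expr1n.
have sD : (-1) ^+ h = (-1) ^+ (h - n) * (-1) ^+ n :> R by rewrite -exprD subnK.
have {}c2 : w * E (H h) = (-1) ^+ h * (h`!%:R * h`!%:R) by rewrite c2 !mulrA sqs mul1r.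
apply: (mulIr Uall).
transitivity (('C(n.*2, n)%:R * n`!%:R) * h`!%:R * (h - n)`!%:R * E (H h) : R).
  by ring.
rewrite c3.
transitivity (2 ^+ n * (h`!%:R * (\prod_(i < n) (i.*2).+1)%:R)
   * (h - n)`!%:R * E (H h) : R); first by ring.
rewrite odds.
transitivity (2 ^+ n * 2 ^+ n * E (- (H (h + n) - H h) / 2) * E (H h) *
  ((h + n)`!%:R * (h - n)`!%:R)); first by ring.
rewrite c1.
transitivity (4 ^+ n * (-1) ^+ (h - n) *
  (E (- (H (h + n) - H h) / 2) * E (H (h - n))) * (w * E (H h))).
  by rewrite -exprMn -natrM; ring.
rewrite e12 c2 sD.
transitivity (((-1) ^+ (h - n) * (-1) ^+ (h - n)) * 4 ^+ n * (-1) ^+ n * E2 *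
   h`!%:R * h`!%:R * E (H h)); first by ring.
by rewrite sqs -{1}hf !natrM; ring.
Qed.

Section Tripling.

Hypothesis p_odd : odd p.
Hypothesis p_mod3 : ~~ (3 %| p)%N.
Notation D := (p %/ 3)%N.

Let c := (p %% 3)%N.

Let p_divE : p = (3 * D + c)%N.
Proof. by rewrite mulnC -divn_eq. Qed.

Let c12 : c = 1%N \/ c = 2%N.
Proof. by rewrite /c; lia. Qed.

Let residue1 i : (3 * (i + D).+1 = (3 * i + (3 - c)) + p)%N.
Proof. have := p_divE; lia. Qed.

Let residue2 i : (3 * (i + (p.-1 - D)).+1 = (3 * i + c) + 2 * p)%N.
Proof. have := p_divE; have := prime_gt1 p_pr; lia. Qed.

Let residues i : ((3 * i).+1 * (3 * i).+2 = (3 * i + (3 - c)) * (3 * i + c))%N.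
Proof. by case: c12 => ->; rewrite ?subn1 ?subn2 /=; lia. Qed.

Let p_gt4 : (4 < p)%N.
Proof. have := prime_gt1 p_pr; have: p != 2%N by [lia]; lia. Qed.

Let three_unit : (3 : R) \is a GRing.unit.
Proof. by rewrite nat_unit // gtnNdvd //; lia. Qed.

Let three_neq0 : (3 : 'F_p) != 0.
Proof. by rewrite Fp_nat_neq0 //; lia. Qed.

(** Gauss's multiplication formula: the numbers up to [3 n] that are prime to [3]
    become multiples of [3] when [p] is added to one residue class and [2 p] to
    the other. *)
Lemma factorial_tripling n : (n <= D)%N ->
  (3 * n)`!%:R * D`!%:R * (p.-1 - D)`!%:R =
  3 ^+ (3 * n) * n`!%:R * (D + n)`!%:R * (p.-1 - D + n)`!%:R *
  E (- (H (D + n) - H D) / 3 - 2 * (H (p.-1 - D + n) - H (p.-1 - D)) / 3) :> R.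
Proof.
move=> nD.
have -> : - (H (D + n) - H D) / 3 = red (- 3^-1) * (H (D + n) - H D).
  by rewrite rmorphN rmorphV //= rmorph_nat; ring.
have -> : - (2 * (H (p.-1 - D + n) - H (p.-1 - D)) / 3) =
    red (- (2 / 3)) * (H (p.-1 - D + n) - H (p.-1 - D)).
  by rewrite rmorphN rmorphM rmorphV //= !rmorph_nat; ring.
rewrite oneunitD.
transitivity (3 ^+ (3 * n) * n`!%:R *
  ((D + n)`!%:R * E (red (- 3^-1) * (H (D + n) - H D))) *
  ((p.-1 - D + n)`!%:R *
    E (red (- (2 / 3)) * (H (p.-1 - D + n) - H (p.-1 - D)))) : R); last by ring.
rewrite -!prod_nat_addp; try lia.
have -> : (3 * n = n + n + n)%N by lia.
rewrite !exprD.
have <- : \prod_(i < n) (3 : R) = 3 ^+ n by rewrite prodr_const card_ord.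
set P1 := \prod_(i < n) (_ + _ * - 3^-1); set P2 := \prod_(i < n) (_ + _ * - _).
set P3 := \prod_(i < n) _.
transitivity (P3 * n`!%:R * ((P3 * P1) * (P3 * P2)) * D`!%:R * (p.-1 - D)`!%:R);
  last by ring.
have -> : (n + n + n = 3 * n)%N by lia.
rewrite triple_fact !natrM; congr (_ * _ * _ * _ * _).
  by rewrite natrX /P3 prodr_const card_ord.
rewrite natr_prod /P3 -!big_split /=; apply: eq_bigr => i _.
rewrite residues natrM; congr (_ * _).
  rewrite mulrDr mulrN mulrN mulrCA divrr // mulr1 -natrM residue1 natrD; ring.
have e : 3 * (2 / 3) = 2 :> R by rewrite mulrCA divrr // mulr1.
have -> : 3 * ((i + (p.-1 - D)).+1%:R + p%:R * - (2 / 3)) =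
    3 * (i + (p.-1 - D)).+1%:R - p%:R * (3 * (2 / 3)) :> R by ring.
by rewrite e -natrM residue2 natrD natrM; ring.
Qed.

(** The same partition of the numbers up to [3 n], applied to the sum of their
    inverses. *)
Lemma harmonic_tripling n : (n <= D)%N ->
  3 * H (3 * n) =
  H n + (H (D + n) - H D) + (H (p.-1 - D + n) - H (p.-1 - D)).
Proof.
move=> nD; rewrite !harmonicD /H.
elim: n nD => [|n IHn] nD; first by rewrite !big_ord0; ring.
have -> : (3 * n.+1 = (3 * n).+3)%N by lia.
rewrite !big_ord_recr /= !mulrDr IHn 1?ltnW //.
have p0 : p%:R = 0 :> 'F_p by rewrite Fp_p_eq0.
have nz m : (0 < m < p)%N -> m%:R != 0 :> 'F_p by exact: Fp_nat_neq0.
have inv3 m k : (0 < m < p)%N -> (0 < k < p)%N -> m%:R = 3 * k%:R :> 'F_p -> 3 * m%:R^-1 = k%:R^-1 :> 'F_p.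
  by move=> m0 k0 ->; field; rewrite three_neq0 nz.
have r1 : 3 * (3 * n + (3 - c))%:R^-1 = (n + D).+1%:R^-1 :> 'F_p.
  apply: inv3; [have := c12; lia|lia|].
  by rewrite -natrM residue1 [RHS]natrD p0 addr0.
have r2 : 3 * (3 * n + c)%:R^-1 = (n + (p.-1 - D)).+1%:R^-1 :> 'F_p.
  apply: inv3; [have := c12; lia|lia|].
  by rewrite -natrM residue2 [RHS]natrD [(2 * p)%:R]natrM p0 mulr0 addr0.
have r3 : 3 * (3 * n).+3%:R^-1 = n.+1%:R^-1 :> 'F_p.
  by apply: inv3; [lia|lia|rewrite -natrM; congr _%:R; lia].
rewrite -r1 -r2 -r3.
by case: c12 => -> /=; rewrite ?subn1 ?subn2 /= !addnS addn0; ring.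
Qed.

(** The tripling formula at its largest index: there the factorials on both
    sides cancel, up to the last factors when [p] is [2] modulo [3]. *)
Lemma three_fermat : 3 ^+ p.-1 = E (- (2 * H D / 3)) :> R.
Proof.
suff e : 3 ^+ p.-1 * E (2 * H D / 3) = 1.
  by apply: (mulIr (oneunit_unit (2 * H D / 3))); rewrite e -oneunitD addNr oneunit0.
have := factorial_tripling (leqnn D).
have -> : (p.-1 - D + D = p.-1)%N by lia.
have -> : H p.-1 = 0 by rewrite -{1}[p.-1]subn0 harmonic_compl ?harmonic0 //; lia.
have -> : H (p.-1 - D) = H D by rewrite harmonic_compl //; lia.
have U m : (m < p)%N -> m`!%:R \is a @GRing.unit R := @fact_unit m.
have pE := p_divE.
have [c1|c2] := c12.
  have e1 : (D + D = p.-1 - D)%N by lia.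
  have e2 : (3 * D = p.-1)%N by lia.
  have -> : H (D + D) = H D by rewrite e1 harmonic_compl //; lia.
  rewrite e2 e1.
  have -> : - (H D - H D) / 3 - 2 * (0 - H D) / 3 = 2 * H D / 3 by ring.
  have Ut : D`!%:R * (p.-1 - D)`!%:R * p.-1`!%:R \is a @GRing.unit R.
    by rewrite !unitrM !U //; lia.
  move=> t; apply: (mulIr Ut); rewrite mul1r.
  by transitivity (p.-1`!%:R * D`!%:R * (p.-1 - D)`!%:R : R); [rewrite t|]; ring.
have e1 : (p.-1 - D = (D + D).+1)%N by lia.
have e2 : (p.-1 = (3 * D).+1)%N by lia.
have -> : H (D + D) = H D + 3.
  have <- : (p.-1 - D.+1 = D + D)%N by lia.
  rewrite harmonic_compl //; last by lia.
  rewrite harmonicS; congr (_ + _); apply: (mulIf (x := D.+1%:R)).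
    by rewrite Fp_nat_neq0 //; lia.
  rewrite mulVf ?Fp_nat_neq0 //; last by lia.
  rewrite -natrM; have -> : (3 * D.+1 = p + 1)%N by lia.
  by rewrite natrD Fp_p_eq0 // add0r.
have -> : - (H D + 3 - H D) / 3 - 2 * (0 - H D) / 3 = 2 * H D / 3 - 1.
  by field; exact: three_neq0.
have -> : p.-1`!%:R = p.-1%:R * (3 * D)`!%:R :> R.
  by rewrite -natrM; congr _%:R; rewrite e2 factS.
have -> : (p.-1 - D)`!%:R = (D + D).+1%:R * (D + D)`!%:R :> R.
  by rewrite e1 factS natrM.
have p1 : p.-1%:R = - E (- 1) :> R.
  by rewrite /E deltaN -p_mulE1 -subn1 natrB ?prime_gt0 //; ring.
have p2 : 3 * (D + D).+1%:R = - (E (- 1) * E (- 1)) :> R.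
  rewrite -oneunitD /E -opprD deltaN deltaD -p_mulE1.
  have e3 : (3 * (D + D).+1 + 1 = 2 * p)%N by lia.
  move/(congr1 (fun n => n%:R : R)): e3; rewrite natrD !natrM => e3.
  transitivity (3 * (D + D).+1%:R + 1 - 1 : R); first by ring.
  by rewrite e3; ring.
move=> t.
have Ut : D`!%:R * (D + D)`!%:R * (3 * D)`!%:R * (E (- 1) * E (- 1))
    \is a @GRing.unit R.
  by rewrite !unitrM !U ?oneunit_unit //; lia.
apply: (mulIr Ut).
transitivity (- (3 * (3 ^+ (3 * D) * D`!%:R * (D + D)`!%:R *
    (p.-1%:R * (3 * D)`!%:R) * E (2 * H D / 3 - 1))) : R).
  by rewrite oneunitD p1 e2 exprS; ring.
rewrite -t mul1r.
transitivity ((- (3 * (D + D).+1%:R)) * (D`!%:R * (D + D)`!%:R * (3 * D)`!%:R) : R).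
  by ring.
by rewrite p2 opprK; ring.
Qed.

End Tripling.

(** * The truncated hypergeometric sum *)

(** The hypergeometric expansion at the origin of the Legendre function of index
    [v], truncated at [p] and written as a polynomial in [v (v + 1)]. *)
Definition legendre_trunc : {poly R} :=
  \sum_(k < p) (k`!%:R ^+ 2 * 2 ^+ k)^-1 *:
    \prod_(j < k) ((j * j.+1)%:R%:P - 'X).

Lemma legendre_truncE (s : R) :
  legendre_trunc.[s] =
  \sum_(k < p) (k`!%:R ^+ 2 * 2 ^+ k)^-1 * \prod_(j < k) ((j * j.+1)%:R - s).
Proof.
rewrite /legendre_trunc horner_sum; apply: eq_bigr => k _.
rewrite hornerZ horner_prod; congr (_ * _); apply: eq_bigr => j _.
by rewrite !hornerE.
Qed.

(** Each factor is [- (r - j) (r + j + 1)]. *)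
Lemma prod_consecutive (r k : nat) : (k <= r)%N ->
  (r - k)`!%:R * \prod_(j < k) ((j * j.+1)%:R - (r * r.+1)%:R) =
  (-1) ^+ k * (r + k)`!%:R :> R.
Proof.
elim: k => [|k IHk] kr; first by rewrite big_ord0 subn0 addn0; ring.
have := IHk (ltnW kr); rewrite big_ord_recr /= exprS addnS.
have f m : (m.+1)`!%:R = m.+1%:R * m`!%:R :> R by rewrite factS natrM.
have -> : (r - k = (r - k.+1).+1)%N by lia.
rewrite !f => e.
have -> : (k * k.+1)%:R - (r * r.+1)%:R = - (r - k.+1).+1%:R * (r + k).+1%:R :> R.
  have -> : (r * r.+1 = k * k.+1 + (r - k.+1).+1 * (r + k).+1)%N.
    by have {1 2 4}-> : r = ((r - k.+1).+1 + k)%N by [lia]; ring.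
  by rewrite natrD natrM; ring.
transitivity (- (r + k).+1%:R * ((r - k.+1).+1%:R * (r - k.+1)`!%:R *
   \prod_(i < k) ((i * i.+1)%:R - (r * r.+1)%:R)) : R); first by ring.
by rewrite e; ring.
Qed.

Section LegendreTruncation.

Hypothesis p_odd : odd p.

Let two_unit : (2 : R) \is a GRing.unit.
Proof. by rewrite nat_unit // gtnNdvd //; have := prime_gt1 p_pr; lia. Qed.

(** At the index [r = 2 n] the truncation is harmless: the factor [j = r]
    vanishes, and the sum stops at [r]. *)
Lemma legendre_trunc_even (n : nat) : (n.*2 < p)%N ->
  4 ^+ n * legendre_trunc.[(n.*2 * (n.*2).+1)%:R] = (-1) ^+ n * 'C(n.*2, n)%:R.
Proof.
set r := n.*2 => rp; rewrite legendre_truncE -(legendre_at_0 R n) -/r.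
have -> : p = (r.+1 + (p - r.+1))%N by lia.
rewrite big_split_ord /= [X in _ + X]big1 ?addr0 => [|k _]; last first.
  have rk : (r < r.+1 + k)%N by lia.
  by rewrite (bigD1 (Ordinal rk)) //= subrr mul0r mulr0.
rewrite mulr_sumr; apply: eq_bigr => k _.
have kr : (k <= r)%N by rewrite -ltnS.
have -> : 4 ^+ n = 2 ^+ (r - k) * 2 ^+ k :> R.
  by rewrite -exprD subnK // /r -mul2n exprM -(natrX R 2 2).
have U m : (m < p)%N -> m`!%:R \is a @GRing.unit R := @fact_unit m.
have Uk : (k`!%:R ^+ 2 * 2 ^+ k) * (r - k)`!%:R \is a @GRing.unit R.
  by rewrite !unitrM !unitrX ?U //; lia.
apply: (mulIr Uk).
have V : (k`!%:R ^+ 2 * 2 ^+ k) \is a @GRing.unit R.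
  by rewrite !unitrM !unitrX ?U //; lia.
transitivity ((k`!%:R ^+ 2 * 2 ^+ k) / (k`!%:R ^+ 2 * 2 ^+ k) * (2 ^+ (r - k) * 2 ^+ k) *
  ((r - k)`!%:R * \prod_(j < k) ((j * j.+1)%:R - (r * r.+1)%:R)) : R); first by ring.
rewrite divrr // mul1r prod_consecutive //.
have e1 : ('C(r, k) * (k`! * (r - k)`!) = r`!)%N by rewrite bin_fact.
have e2 : ('C(r + k, k) * (k`! * r`!) = (r + k)`!)%N.
  by have := @bin_fact (r + k) k; rewrite addnK leq_addl; apply.
rewrite -e2 -e1 !natrM; ring.
Qed.

Lemma legendre_trunc_binomial (n : nat) : (n <= p./2)%N ->
  legendre_trunc.[(n.*2 * (n.*2).+1)%:R] =
  'C(p./2, n)%:R * E ((H (p./2 - n) - H p./2) / 2).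
Proof.
move=> nh; have u4 : (4 ^+ n : R) \is a GRing.unit.
  by rewrite unitrX // (natrM R 2 2) unitrM two_unit.
apply: (mulrI u4); rewrite legendre_trunc_even; last by lia.
rewrite central_binomial //.
have s1 : (-1) ^+ n * (-1) ^+ n = 1 :> R by rewrite -exprMn mulrNN mulr1 expr1n.
transitivity (((-1) ^+ n * (-1) ^+ n) * 4 ^+ n * ('C(p./2, n)%:R *
   E ((H (p./2 - n) - H p./2) / 2))); first by ring.
by rewrite s1 mul1r.
Qed.

Hypothesis p_gt3 : (3 < p)%N.

Let six_unit : (6 : R) \is a GRing.unit.
Proof.
rewrite nat_unit //; apply/negP; rewrite -[6%N]/(2 * 3)%N Euclid_dvdM //.
by case/orP => /dvdn_leq; lia.
Qed.

(** At [- 5 / 36] the [j]-th factor is [(6 j + 1) (6 j + 5) / 36]. *)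
Lemma sextic_sumE :
  \sum_(k < p) 'C(6 * k, 3 * k)%:R * 'C(3 * k, k)%:R / 864 ^+ k =
  legendre_trunc.[- 5 / 36].
Proof.
rewrite legendre_truncE; apply: eq_bigr => k _.
have U : k`!%:R \is a @GRing.unit R by apply: fact_unit.
have u36 : (36 : R) \is a GRing.unit by rewrite (natrM R 6 6) unitrM six_unit.
have e864 : 864 = 12 * (36 * 2) :> R by rewrite -!natrM.
have u12 : (12 : R) \is a GRing.unit by rewrite (natrM R 6 2) unitrM six_unit.
have uu : (k`!%:R * k`!%:R) * 864 ^+ k \is a @GRing.unit R.
  by rewrite !unitrM U unitrX // e864 !unitrM u12 u36.
have u1 : 864 ^+ k \is a @GRing.unit R by move: uu; rewrite unitrM => /andP[].
have u2 : k`!%:R ^+ 2 * 2 ^+ k \is a @GRing.unit R.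
  by rewrite unitrM !unitrX.
apply: (mulIr uu).
transitivity (('C(6 * k, 3 * k) * 'C(3 * k, k) * (k`! * k`!))%:R : R).
  transitivity (864 ^+ k / 864 ^+ k * ('C(6 * k, 3 * k) * 'C(3 * k, k) * (k`! * k`!))%:R : R).
    by rewrite !natrM; ring.
  by rewrite divrr // mul1r.
rewrite bin6_bin3 natrM natr_prod natrX.
transitivity ((k`!%:R ^+ 2 * 2 ^+ k) / (k`!%:R ^+ 2 * 2 ^+ k) * 12 ^+ k *
  (36 ^+ k * \prod_(j < k) ((j * j.+1)%:R - - 5 / 36)) : R); last first.
  by rewrite e864 !exprMn; ring.
rewrite divrr // mul1r; congr (_ * _).
have -> : 36 ^+ k = \prod_(j < k) (36 : R) by rewrite prodr_const card_ord.
rewrite -big_split; apply: eq_bigr => j _ /=.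
have -> : ((6 * j + 1) * (6 * j + 5) = 36 * (j * j.+1) + 5)%N by ring.
rewrite mulrBr [36 * (_ / _)]mulrCA divrr // mulr1 natrD [(36 * _)%:R]natrM; ring.
Qed.

(** Let [s0] and [s1] be the values of [v (v + 1)] at [v = 2 n] and at
    [v = p - 1 - 2 n]. Their difference is a multiple of [p], so the truncated
    polynomial is affine on the line through them, and [- 5 / 36] is
    [s0 + (s1 - s0) / 6]. *)
Lemma sextic_sum_interpolation (n : nat) :
    (6 * n.*2 + 1 = p)%N \/ (6 * n.*2 + 5 = p)%N ->
  \sum_(k < p) 'C(6 * k, 3 * k)%:R * 'C(3 * k, k)%:R / 864 ^+ k =
  'C(p./2, n)%:R *
    E ((5 * H (p./2 - n) + H n) / 12 - H p./2 / 2).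
Proof.
move=> pn; rewrite sextic_sumE.
set h := p./2; set m := (h - n)%N.
have nh : (n <= h)%N by rewrite /h; lia.
set s0 : R := (n.*2 * (n.*2).+1)%:R.
set s1 : R := (m.*2 * (m.*2).+1)%:R.
set r : R := n.*2%:R.
have m2 : m.*2%:R = p%:R - 1 - r.
  have e : (m.*2 + 1 + n.*2 = p)%N by rewrite /m /h; lia.
  by rewrite -e !natrD; ring.
have s1E : s1 - s0 = - (p%:R * (2 * r + 1)).
  rewrite /s1 /s0 !natrM -[(m.*2).+1]addn1 -[(n.*2).+1]addn1 !natrD m2 -/r.
  transitivity (p%:R * p%:R - p%:R * (2 * r + 1) : R); first by ring.
  by rewrite sqr_p sub0r.
have u36 : (36 : R) \is a GRing.unit by rewrite (natrM R 6 6) unitrM six_unit.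
have six : 36 / 6 = 6 :> R by rewrite (natrM R 6 6) (mulrK six_unit).
have sE : - 5 / 36 = s0 + (s1 - s0) / 6.
  apply: (mulrI u36); rewrite mulrCA divrr // mulr1 mulrDr mulrCA six s1E.
  have e0 : 36 * s0 = (6 * r + 1) * (6 * r + 5) - 5.
    by rewrite /s0 natrM -[(n.*2).+1]addn1 natrD -/r; ring.
  have -> : - (p%:R * (2 * r + 1)) * 6 = - (p%:R * (2 * (6 * r) + 6)) by ring.
  rewrite e0; transitivity (- (p%:R * p%:R) - 5 : R); first by rewrite sqr_p oppr0 add0r.
  case: pn => e.
  - have -> : 6 * r = p%:R - 1 by rewrite -e natrD natrM addrK.
    by ring.
  - have -> : 6 * r = p%:R - 5 by rewrite -e natrD natrM addrK.
    by ring.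
have y0 : (s1 - s0) * (s1 - s0) = 0.
  by rewrite s1E mulrNN mulrACA sqr_p mul0r.
have f1 : legendre_trunc.[s1] = legendre_trunc.[s0] + legendre_trunc^`().[s0] * (s1 - s0).
  by rewrite -horner_sqr_zero // addrC subrK.
have f : legendre_trunc.[- 5 / 36] =
    (5 * legendre_trunc.[s0] + legendre_trunc.[s1]) / 6.
  rewrite sE horner_sqr_zero; last by rewrite mulrACA y0 mul0r.
  rewrite f1; apply: (mulIr six_unit); rewrite (mulrVK six_unit).
  have six1 : 6^-1 * 6 = 1 :> R by rewrite (mulVr six_unit).
  transitivity (6 * legendre_trunc.[s0] + legendre_trunc^`().[s0] * (s1 - s0) * (6^-1 * 6)).
    by ring.
  by rewrite six1; ring.
rewrite {}f legendre_trunc_binomial // legendre_trunc_binomial -/h /m ?leq_subr //.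
rewrite subKn // bin_sub //.
set x := (H m - H h) / 2; set y := (H n - H h) / 2.
have -> : (5 * H m + H n) / 12 - H h / 2 = (5 * x + y) / 6.
  have f6 : (6 : 'F_p) != 0 by rewrite -(rmorph_nat red) -unitRE six_unit.
  have f2 : (2 : 'F_p) != 0 by rewrite Fp_nat_neq0 //; lia.
  have f12 : (12 : 'F_p) != 0 by rewrite (natrM _ 6 2) mulf_neq0.
  by rewrite /x /y; field; rewrite ?f2 ?f6 ?f12.
apply: (mulIr six_unit); rewrite (mulrVK six_unit).
have e : 5 * delta x + delta y = 6 * delta ((5 * x + y) / 6).
  rewrite !mul_delta -deltaD !rmorph_nat [6 * (_ / _)]mulrCA divff ?mulr1 //.
  by rewrite -(rmorph_nat red) -unitRE six_unit.
transitivity ('C(h, n)%:R * (6 + 6 * delta ((5 * x + y) / 6)) : R).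
  by rewrite -e /E; ring.
by rewrite /E; ring.
Qed.

End LegendreTruncation.

(** * Reduction of the sum to one binomial coefficient *)

Lemma exp_p_red (x y : R) : red x = red y -> x ^+ p = y ^+ p.
Proof.
move=> xy; have [|c] := @red_ker (x - y); first by rewrite rmorphB xy subrr.
move/eqP; rewrite subr_eq addrC => /eqP ->.
have := @horner_sqr_zero R 'X^p y (p%:R * c).
rewrite !hornerXn derivXn hornerMn hornerXn => ->.
  by rewrite -mulr_natl mulrACA sqr_p mul0r addr0.
by rewrite mulrACA sqr_p mul0r.
Qed.

Definition teichmuller (x : 'F_p) : R := lift x ^+ p.

Lemma red_teichmuller x : red (teichmuller x) = x.
Proof. by rewrite rmorphXn red_lift Fp_fermat. Qed.

Lemma exp_pE (x : R) : x ^+ p = teichmuller (red x).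
Proof. by apply: exp_p_red; rewrite red_lift. Qed.

Lemma teichmullerM x y : teichmuller (x * y) = teichmuller x * teichmuller y.
Proof. by rewrite -exprMn; apply: exp_p_red; rewrite rmorphM !red_lift. Qed.

Lemma teichmuller0 : teichmuller 0 = 0.
Proof. by rewrite -(rmorph0 red) -exp_pE expr0n eqn0Ngt prime_gt0. Qed.

Lemma teichmuller1 : teichmuller 1 = 1.
Proof. by rewrite -(rmorph1 red) -exp_pE expr1n. Qed.

Lemma teichmullerX x n : teichmuller (x ^+ n) = teichmuller x ^+ n.
Proof.
by elim: n => [|n IHn]; rewrite ?expr0 ?teichmuller1 // !exprS teichmullerM IHn.
Qed.

Section QuarterIndices.

Hypothesis p_mod4 : (p %% 4 = 1)%N.
Hypothesis p_mod3 : ~~ (3 %| p)%N.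

Notation h := (p./2).
Notation q := (p %/ 4)%N.
Notation A := (p %/ 12)%N.
Notation B := (h - A)%N.
Notation D := (p %/ 3)%N.

Let p_odd : odd p.
Proof. lia. Qed.

(** By [central_binomial] at [n = q], this is [(-1)^q C(h, q) / 2^h]. When
    [p = a^2 + b^2] with [a] congruent to [1] modulo [4], it turns out to be the
    unit root of [X^2 - 2 a X + p]. *)
Definition quartic_unit_root : R := 'C(h, q)%:R * E ((H q - H h) / 2).

Lemma quartic_unit_root_unit : quartic_unit_root \is a GRing.unit.
Proof.
rewrite unitrM oneunit_unit andbT.
have qh : (q <= h)%N by lia.
have : h`!%:R \is a @GRing.unit R by apply: fact_unit; have := prime_gt1 p_pr; lia.
by rewrite -(bin_fact qh) natrM unitrM => /andP[].
Qed.

Let four : (4 : 'F_p) != 0 /\ (3 : 'F_p) != 0 /\ (2 : 'F_p) != 0.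
Proof. by have p1 := prime_gt1 p_pr; rewrite !Fp_nat_neq0 //; lia. Qed.

(** The tripling formula at [n = q], once [fact_compl] has brought every factorial
    below [h]; the factorials that depend on [p/3] cancel. *)
Lemma binomial_tripling :
  3 ^+ (3 * q) * 'C(h, A)%:R * E (H A / 3 + 2 * H B / 3 - H q) =
  (-1) ^+ A * 'C(h, q)%:R :> R.
Proof.
have p1 := prime_gt1 p_pr.
have := @factorial_tripling p_odd p_mod3 q.
have -> : (D + q = p.-1 - B)%N by lia.
have -> : (p.-1 - D + q = p.-1 - A)%N by lia.
have -> : (3 * q = p.-1 - q)%N by lia.
rewrite !harmonic_compl //; try lia.
set e := - (H B - H D) / 3 - _ => t; have {}t := t ltac:(lia).
have sqs m : (-1) ^+ m * (-1) ^+ m = 1 :> R by rewrite -exprMn mulrNN mulr1 expr1n.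
have U m : (m < p)%N -> m`!%:R \is a @GRing.unit R := @fact_unit m.
have cq := @fact_compl q; have cA := @fact_compl A.
have cB := @fact_compl B; have cD := @fact_compl D.
have {}cq := cq ltac:(lia); have {}cA := cA ltac:(lia).
have {}cB := cB ltac:(lia); have {}cD := cD ltac:(lia).
have sAB : (-1) ^+ A * (-1) ^+ B = 1 :> R.
  by rewrite -exprD -signr_odd; have -> : odd (A + B) = false by lia.
have sqD : (-1) ^+ q * (-1) ^+ D = (-1) ^+ A :> R.
  have -> : D = (A + q)%N by lia.
  by rewrite exprD mulrCA sqs mulr1.
have t1 : A`!%:R * B`!%:R * (-1) ^+ A * E (H q + H D) =
    3 ^+ (p.-1 - q) * (q`!%:R * q`!%:R) * E (H A + H B + e).
  have Uw : w * w \is a GRing.unit by rewrite unitrM U // prednK ?prime_gt0.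
  apply: (mulIr Uw).
  transitivity (((p.-1 - q)`!%:R * q`!%:R) * ((p.-1 - D)`!%:R * D`!%:R) *
     A`!%:R * B`!%:R : R).
    by rewrite cq cD -sqD oneunitD; ring.
  transitivity (((p.-1 - q)`!%:R * D`!%:R * (p.-1 - D)`!%:R) * (q`!%:R *
     A`!%:R * B`!%:R) : R); first by ring.
  rewrite t.
  transitivity (3 ^+ (p.-1 - q) * q`!%:R * q`!%:R * ((p.-1 - B)`!%:R * B`!%:R) *
    ((p.-1 - A)`!%:R * A`!%:R) * E e : R); first by ring.
  rewrite cA cB 2!oneunitD.
  transitivity (3 ^+ (p.-1 - q) * q`!%:R * q`!%:R * w * w * ((-1) ^+ A * (-1) ^+ B) *
    E (H A) * E (H B) * E e : R); first by ring.
  by rewrite sAB; ring.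
have bA : ('C(h, A) * (A`! * B`!) = h`!)%N by rewrite bin_fact //; lia.
have bq : ('C(h, q) * (q`! * q`!) = h`!)%N.
  by rewrite -(@bin_fact h q); [congr (_ * (_ * _`!))%N; lia | lia].
have eE : H A / 3 + 2 * H B / 3 - H q = (H A + H B + e) - (H q + H D).
  by rewrite /e; have [_ [f3 _]] := four; field.
have UU : q`!%:R * q`!%:R * h`!%:R * E (H q + H D) \is a @GRing.unit R.
  by rewrite !unitrM !U ?oneunit_unit //; lia.
apply: (mulIr UU).
have E1 : E (H A / 3 + 2 * H B / 3 - H q) * E (H q + H D) = E (H A + H B + e).
  by rewrite -oneunitD eE subrK.
transitivity (h`!%:R * 'C(h, A)%:R * (3 ^+ (p.-1 - q) * (q`!%:R * q`!%:R) * E (H A + H B + e)) : R).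
  by rewrite -E1; ring.
rewrite -t1 -{1}bq -bA !natrM; ring.
Qed.

Lemma harmonic_quarter : H A + H B = 2 * H q + 2 * H D.
Proof.
have p1 := prime_gt1 p_pr.
have := @harmonic_tripling p_odd p_mod3 q.
have -> : (D + q = p.-1 - B)%N by lia.
have -> : (p.-1 - D + q = p.-1 - A)%N by lia.
have -> : (3 * q = p.-1 - q)%N by lia.
rewrite !harmonic_compl //; try lia.
move=> t; have {}t := t ltac:(lia).
transitivity (H q + (H B - H D) + (H A - H D) - H q + 2 * H D); first by ring.
by rewrite -t; ring.
Qed.

(** The power [t(3)^q] is [3^(p q)], and [p q + 3 q = (p - 1) (q + 1)]. Hence it
    differs from the [3^(- 3 q)] of [binomial_tripling] by a power of [3^(p-1)],
    that is, by a first-order factor; it is the one left over by the harmonic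
    numbers. *)
Lemma sextic_sum_unit_root :
  \sum_(k < p) 'C(6 * k, 3 * k)%:R * 'C(3 * k, k)%:R / 864 ^+ k =
  (-1) ^+ A * teichmuller 3 ^+ q * quartic_unit_root.
Proof.
have p1 := prime_gt1 p_pr.
have [f4 [f3 f2]] := four.
rewrite (@sextic_sum_interpolation p_odd _ A); [|lia|lia].
have u3 : (3 ^+ (3 * q) : R) \is a GRing.unit.
  by rewrite unitrX // nat_unit // gtnNdvd //; lia.
have q4 : q%:R = - 4^-1 :> 'F_p.
  apply: (mulIf f4); rewrite mulNr mulVf // -natrM.
  have /(congr1 (fun n => n%:R : 'F_p)) : (q * 4 + 1 = p)%N by lia.
  by rewrite natrD Fp_p_eq0 // => /eqP; rewrite addr_eq0 => /eqP.
have t3 : 3 ^+ (3 * q) * teichmuller 3 ^+ q = E (- H D / 2).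
  have -> : 3 = red 3 by rewrite rmorph_nat.
  rewrite -exp_pE -exprM -exprD.
  have -> : (3 * q + p * q = p.-1 * q.+1)%N by nia.
  rewrite exprM three_fermat // oneunitX; congr E.
  by rewrite -natr1 q4; field; rewrite f4 f3 f2.
apply: (mulrI u3); rewrite !mulrA [3 ^+ (3 * q) * (-1) ^+ _]mulrC -[_ * _ * teichmuller 3 ^+ q]mulrA t3.
set x := H A / 3 + 2 * H B / 3 - H q.
apply: (mulIr (oneunit_unit x)).
transitivity ((3 ^+ (3 * q) * 'C(h, A)%:R * E x) * E ((5 * H B + H A) / 12 - H h / 2)).
  by ring.
rewrite binomial_tripling /quartic_unit_root.
transitivity ((-1) ^+ A * 'C(h, q)%:R * (E (- H D / 2) * E ((H q - H h) / 2) * E x)); last by ring.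
rewrite -!oneunitD; congr (_ * E _).
have f12 : (12 : 'F_p) != 0 by rewrite (natrM _ 4 3) mulf_neq0.
have -> : H A = 2 * H q + 2 * H D - H B by rewrite -harmonic_quarter addrK.
rewrite /x.
have -> : H A = 2 * H q + 2 * H D - H B by rewrite -harmonic_quarter addrK.
by field; rewrite f12 f3 f2.
Qed.

End QuarterIndices.

(** * The binomial coefficient as a Jacobi sum *)

Section UnitRoot.

Hypothesis p_mod4 : (p %% 4 = 1)%N.

Notation h := (p./2).
Notation q := (p %/ 4)%N.

Lemma teichmuller_sum n : (0 < n)%N ->
  \sum_z teichmuller z ^+ n = (if (p.-1 %| n)%N then p.-1%:R else 0) :> R.
Proof.
move=> n0; have [g gp] := Fp_primitive_root p_pr.
have z0n : teichmuller 0 ^+ n = 0 by rewrite teichmuller0 expr0n eqn0Ngt n0.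
case: ifP => pn.
  rewrite (bigD1 0) //= z0n add0r (eq_bigr (fun=> 1)) => [|z z0]; last first.
    rewrite -teichmullerX; case/dvdnP: pn => k ->.
    by rewrite mulnC exprM Fp_fermat1 // expr1n teichmuller1.
  by rewrite sumr_const cardC1 card_Fp.
have gn : g ^+ n != 1 by rewrite -(prim_order_dvd gp) pn.
have g0 : g != 0.
  apply: contraFneq pn => e; move: (prim_expr_order gp); rewrite e expr0n.
  have -> : (p.-1 == 0)%N = false by have := prime_gt1 p_pr; lia.
  by move/eqP; rewrite eq_sym oner_eq0.
have u : teichmuller g ^+ n - 1 \is a GRing.unit.
  by rewrite unitRE rmorphB rmorphXn red_teichmuller rmorph1 subr_eq0.
apply: (mulrI u); rewrite mulr0 mulrBl mul1r mulr_sumr.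
rewrite [X in _ - X](reindex_inj (mulfI g0)) /= -sumrB big1 // => z _.
by rewrite teichmullerM exprMn subrr.
Qed.

Lemma teichmuller_binomial_sum k N : (0 < k)%N ->
  \sum_z teichmuller z ^+ k * (1 - teichmuller z) ^+ N =
  p.-1%:R * \sum_(j < N.+1 | (p.-1 %| k + j)%N) (-1) ^+ j * 'C(N, j)%:R.
Proof.
move=> k0.
transitivity (\sum_z \sum_(j < N.+1)
    (-1) ^+ j * 'C(N, j)%:R * teichmuller z ^+ (k + j)).
  apply: eq_bigr => z _; rewrite exprDn mulr_sumr; apply: eq_bigr => j _.
  by rewrite expr1n mul1r [(- teichmuller z) ^+ j]exprNn -mulr_natr exprD; ring.
rewrite exchange_big mulr_sumr [RHS]big_mkcond; apply: eq_bigr => j _ /=.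
rewrite -mulr_sumr teichmuller_sum ?addn_gt0 ?k0 //.
by case: ifP => _; ring.
Qed.

(** For a unit [y], the power [y^(h + (p - 1) t)] is affine in [t], because
    [y^(p - 1) - 1] is a multiple of [p]. The left side is the power
    [y^(p h)] of [y = 1 - t(z)], at [t = h]; the right side interpolates it
    between [t = 0] and [t = 1]. *)
Lemma teichmuller_compl_pow z :
  teichmuller (1 - z) ^+ h =
  (1 - h%:R) * (1 - teichmuller z) ^+ h + h%:R * (1 - teichmuller z) ^+ (3 * h).
Proof.
have p1 := prime_gt1 p_pr.
have h0 : (0 < h)%N by lia.
set y := 1 - teichmuller z.
have ry : red y = 1 - z by rewrite rmorphB rmorph1 red_teichmuller.
rewrite -ry -exp_pE.
have [z1|z1] := eqVneq z 1.
  have -> : y = 0 by rewrite /y z1 teichmuller1 subrr.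
  by rewrite -exprM !expr0n !eqn0Ngt !muln_gt0 h0 prime_gt0 //; ring.
have [|c yc] := @red_eq1 (y ^+ p.-1).
  by rewrite rmorphXn /= ry Fp_fermat1 // subr_eq0 eq_sym.
have -> : y ^+ p ^+ h = y ^+ h * y ^+ p.-1 ^+ h.
  by rewrite -!exprM -exprD; congr (y ^+ _); nia.
have -> : y ^+ (3 * h) = y ^+ h * y ^+ p.-1.
  by rewrite -exprD; congr (y ^+ _); lia.
rewrite yc oneunitX /E; have -> : delta (h%:R * c) = h%:R * delta c.
  by rewrite mul_delta rmorph_nat.
by ring.
Qed.

(** Expanding by the binomial theorem, only the exponents divisible by [p - 1]
    survive: [j = q] for the power [h], and the symmetric [j = q] and [j = 5 q]
    for the power [3 h]. *)
Lemma quartic_binomial_sum :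
  \sum_z teichmuller z ^+ (3 * q) * teichmuller (1 - z) ^+ h =
  - ((-1) ^+ q * quartic_unit_root).
Proof.
have p1 := prime_gt1 p_pr.
have hq : h = q.*2 by lia.
have p4 : (p.-1 = 4 * q)%N by lia.
have q0 : (0 < q)%N by lia.
transitivity (\sum_z ((1 - h%:R) * (teichmuller z ^+ (3 * q) * (1 - teichmuller z) ^+ h) +
   h%:R * (teichmuller z ^+ (3 * q) * (1 - teichmuller z) ^+ (3 * h)))).
  by apply: eq_bigr => z _; rewrite teichmuller_compl_pow; ring.
rewrite big_split -!mulr_sumr /= !teichmuller_binomial_sum ?muln_gt0 //.
have dv j : (p.-1 %| 3 * q + j)%N = (4 * q %| 3 * q + j)%N by rewrite p4.
have qh : (q < h.+1)%N by lia.
have q3h : (q < (3 * h).+1)%N by lia.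
have q5h : (5 * q < (3 * h).+1)%N by lia.
have dq : (p.-1 %| 3 * q + q)%N by rewrite dv; apply/dvdnP; exists 1%N; lia.
have dq5 : (p.-1 %| 3 * q + 5 * q)%N by rewrite dv; apply/dvdnP; exists 2%N; lia.
have only j : (j < (3 * h).+1)%N -> (p.-1 %| 3 * q + j)%N -> j = q \/ j = (5 * q)%N.
  move=> jh; rewrite dv => /dvdnP[k kE].
  have k3 : (k < 3)%N by rewrite -(@ltn_pmul2r (4 * q)) ?muln_gt0 //; lia.
  have k1 : (0 < k)%N by case: k kE k3 => //; lia.
  by case: k kE k3 k1 => [|[|[|k]]] //; lia.
have -> : \sum_(j < h.+1 | (p.-1 %| 3 * q + j)%N) (-1) ^+ j * 'C(h, j)%:R =
    (-1) ^+ q * 'C(h, q)%:R :> R.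
  rewrite (big_pred1 (Ordinal qh)) // => j; apply/idP/eqP => [/only|-> //].
  have jh := ltn_ord j.
  case; [lia| by move=> e; apply: val_inj | by lia].
have -> : \sum_(j < (3 * h).+1 | (p.-1 %| 3 * q + j)%N) (-1) ^+ j * 'C(3 * h, j)%:R =
    2 * (-1) ^+ q * 'C(3 * h, q)%:R :> R.
  rewrite (bigD1 (Ordinal q3h)) // (big_pred1 (Ordinal q5h)) /= => [|j].
    have -> : 'C(3 * h, 5 * q) = 'C(3 * h, q).
      by rewrite -bin_sub; [congr 'C(_, _); lia | lia].
    have -> : (-1) ^+ (5 * q) = (-1) ^+ q :> R.
      by rewrite -signr_odd oddM /= signr_odd.
    by ring.
  apply/andP/eqP => [[/only e jq]|->]; last first.
    by split=> //; rewrite -val_eqE /=; lia.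
  apply: val_inj => /=; case: (e (ltn_ord j)) => // e'.
  by case/eqP: jq; apply: val_inj.
have c2 : ('C(h, q) = 2 * 'C(h.-1, q))%N.
  have := mul_bin_down h q; have -> : (h - q = q)%N by lia.
  by rewrite {1}hq -muln2 -mulnA => /eqP; rewrite eqn_pmul2l // => /eqP.
have f2 : (2 : 'F_p) != 0 by rewrite Fp_nat_neq0 //; lia.
have f4 : (4 : 'F_p) != 0 by rewrite (natrM _ 2 2) mulf_neq0.
have hF : h%:R = - 2^-1 :> 'F_p.
  apply: (mulIf f2); rewrite mulNr mulVf // -natrM.
  have /(congr1 (fun n => n%:R : 'F_p)) : (h * 2 + 1 = p)%N by lia.
  by rewrite natrD Fp_p_eq0 // => /eqP; rewrite addr_eq0 => /eqP.
have qF : q%:R = - 4^-1 :> 'F_p.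
  apply: (mulIf f4); rewrite mulNr mulVf // -natrM.
  have /(congr1 (fun n => n%:R : 'F_p)) : (q * 4 + 1 = p)%N by lia.
  by rewrite natrD Fp_p_eq0 // => /eqP; rewrite addr_eq0 => /eqP.
have c3 : 'C(3 * h, q)%:R = 'C(h.-1, q)%:R * E (H h - H q - 2) :> R.
  have uq : q`!%:R \is a @GRing.unit R by apply: fact_unit => //; lia.
  apply: (mulIr uq); rewrite mulrAC -!natrM !bin_ffact !ffact_prod.
  rewrite !natr_prod.
  have -> : H h - H q - 2 = red 1 * \sum_(i < q) (red (h.-1 - i)%:R)^-1.
    rewrite rmorph1 mul1r (reindex_inj rev_ord_inj) /=.
    transitivity (H (q.-1 + q) - H q.-1).
      have e1 : h = (q.-1 + q).+1 by lia.
      have -> : H h = H (q.-1 + q) + h%:R^-1 by rewrite [in LHS]e1 harmonicS -e1.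
      have -> : H q = H q.-1 + q%:R^-1 by rewrite -{1}(prednK q0) harmonicS prednK.
      by rewrite hF qF !invrN !invrK; ring.
    rewrite harmonicD; apply: eq_bigr => i _; rewrite rmorph_nat.
    by congr (_%:R^-1); move: (ltn_ord i); clear -hq q0; lia.
  rewrite -(@prod_addp q (fun i => (h.-1 - i)%:R)) => [|i iq]; last first.
    by apply: red_nat_neq0 => //; lia.
  apply: eq_bigr => i _; rewrite mulr1 -natrD; congr _%:R.
  by move: (ltn_ord i); clear -hq q0 p1 p4; lia.
rewrite c3 /quartic_unit_root c2 natrM.
have -> : (H q - H h) / 2 = -1 + h%:R * (H h - H q - 2).
  by rewrite hF; field; rewrite f2.
have -> : p.-1%:R = - E (- 1) :> R.
  by rewrite /E deltaN -p_mulE1 -subn1 natrB ?prime_gt0 //; ring.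
rewrite [E (- 1 + _)]oneunitD.
have -> : E (h%:R * (H h - H q - 2)) = 1 + h%:R * delta (H h - H q - 2).
  by rewrite mul_delta rmorph_nat.
rewrite [E (H h - H q - 2)]/E; ring.
Qed.

Variable i0 : 'F_p.
Hypothesis i0_sqr : i0 * i0 = -1.
Variable chi : 'F_p -> gaussInt.
Hypothesis chi_values : forall x, chi x \in quartic_values.
Hypothesis chi_eval : forall x, gauss_eval i0 (chi x) = x ^+ q.

Notation I := (teichmuller i0).

Lemma teichmuller_i_sqr : I * I = -1.
Proof.
rewrite -teichmullerM i0_sqr.
have -> : -1 = red (-1) by rewrite rmorphN rmorph1.
by rewrite -exp_pE -signr_odd; have -> : odd p by lia.
Qed.

Lemma gauss_eval_teichmuller z : z \in quartic_values ->
  gauss_eval I z = teichmuller (gauss_eval i0 z).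
Proof.
have tN x : teichmuller (- x) = - teichmuller x.
  by rewrite -mulN1r teichmullerM -i0_sqr teichmullerM teichmuller_i_sqr mulN1r.
rewrite !inE => /orP[/eqP->|/or4P[]/eqP->];
rewrite ?gauss_evalN ?gauss_eval0 ?gauss_eval1 ?gauss_eval_i ?tN
  ?teichmuller0 ?teichmuller1 //.
Qed.

Lemma gauss_eval_char x : gauss_eval I (chi x) = teichmuller x ^+ q.
Proof. by rewrite gauss_eval_teichmuller // chi_eval teichmullerX. Qed.

Lemma gauss_eval_jacobi_sum :
  gauss_eval I (gauss_conj (quartic_jacobi_sum chi)) =
  - ((-1) ^+ q * quartic_unit_root).
Proof.
rewrite -quartic_binomial_sum /quartic_jacobi_sum gauss_conj_sum gauss_eval_sum.
have iI := teichmuller_i_sqr.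
apply: eq_bigr => z _.
rewrite gauss_conjM gauss_evalM // [gauss_conj (chi z)]quartic_values_conj //.
rewrite (quadratic_char_conj p_pr p_mod4 i0_sqr chi_values chi_eval).
rewrite !gauss_evalX // !gauss_eval_char -!exprM; congr (_ ^+ _ * _ ^+ _).
  by rewrite [(q * 3)%N]mulnC.
by congr (_ * _)%N; lia.
Qed.

Lemma sextic_sum_gauss_eval : ~~ (3 %| p)%N ->
  let S := \sum_(k < p) 'C(6 * k, 3 * k)%:R * 'C(3 * k, k)%:R / 864 ^+ k in
  S \is a GRing.unit /\
  S = gauss_eval I (- (-1) ^+ (p %/ 12 + q) * chi 3 *
                    gauss_conj (quartic_jacobi_sum chi)).
Proof.
move=> p3 S; rewrite /S sextic_sum_unit_root //; split.
  have u3 : teichmuller 3 \is a GRing.unit.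
    rewrite unitRE red_teichmuller Fp_nat_neq0 //.
    by have := prime_gt1 p_pr; lia.
  rewrite unitrM quartic_unit_root_unit // andbT unitrM.
  by apply/andP; split; apply: unitrX; rewrite ?unitrN1.
have iI := teichmuller_i_sqr.
have sqs m : (-1) ^+ m * (-1) ^+ m = 1 :> R by rewrite -exprMn mulrNN mulr1 expr1n.
rewrite !gauss_evalM // gauss_evalN gauss_evalX // gauss_evalN gauss_eval1.
rewrite gauss_eval_jacobi_sum gauss_eval_char exprD.
transitivity (((-1) ^+ q * (-1) ^+ q) * ((-1) ^+ (p %/ 12) * teichmuller 3 ^+ q *
  quartic_unit_root)); first by rewrite sqs mul1r.
by ring.
Qed.

End UnitRoot.

End SquareZeroExtension.

(** * From Gaussian integers back to rational numbers *)

Section UnitRootEquation.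

Variables (p : nat) (R : comUnitRingType) (I : R).
Hypothesis sqr_p : p%:R * p%:R = 0 :> R.
Hypothesis I_sqr : I * I = -1.

(** Write [S] and [S'] for the images of [z] and of its conjugate. Then
    [S + S' = 2 c] and [S * S' = p]; since [S] is a unit, [S'] is a multiple of
    [p] and has square zero, so [S] is [2 c - p / (2 c)]. *)
Lemma gauss_eval_unit_root z :
    gauss_eval I z \is a GRing.unit -> z * gauss_conj z = p%:R ->
    (2 * z.1%:~R : R) \is a GRing.unit ->
  gauss_eval I z = 2 * z.1%:~R - p%:R / (2 * z.1%:~R).
Proof.
move=> Su zp cu; apply: (mulIr cu); rewrite mulrBl divrK //.
set c := 2 * _ in cu *.
set S := gauss_eval I z; set S' := gauss_eval I (gauss_conj z).
have SS' : S * S' = p%:R.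
  by rewrite -gauss_evalM // zp gauss_natE /gauss_eval /= mul0r addr0 pmulrn.
have cE : c = S + S'.
  by rewrite /S /S' /gauss_eval /c /= rmorphN /=; ring.
have pS' : p%:R * S' = 0.
  by apply: (mulrI Su); rewrite mulr0 mulrCA SS' sqr_p.
have S'2 : S' * S' = 0.
  by apply: (mulrI Su); rewrite mulr0 mulrA SS' pS'.
rewrite cE -SS'; transitivity ((S + S') * (S + S') - S * S' - S' * S'); last by rewrite S'2 subr0.
by ring.
Qed.

End UnitRootEquation.

Lemma Fp_nat_mod_sqr (p : nat) (m : nat) : prime p -> (m %% p ^ 2)%:R = m%:R :> 'F_p.
Proof.
move=> p_pr; rewrite [in RHS](divn_eq m (p ^ 2)) natrD natrM natrX Fp_p_eq0 //.
by rewrite expr0n mulr0 add0r.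
Qed.

Lemma reduction_mod_p (p : nat) : prime p ->
  exists2 red : {rmorphism 'Z_(p ^ 2) -> 'F_p},
    p%:R * p%:R = 0 :> 'Z_(p ^ 2) &
    forall x, red x = 0 -> exists c, x = p%:R * c.
Proof.
move=> p_pr; have p1 := prime_gt1 p_pr.
have p21 : (1 < p ^ 2)%N by rewrite -mulnn; nia.
pose f (x : 'Z_(p ^ 2)) : 'F_p := (x : nat)%:R.
have fn n : f n%:R = n%:R by rewrite /f val_Zp_nat // Fp_nat_mod_sqr.
have fA x y : f (x + y) = f x + f y.
  by rewrite -{1}[x]natr_Zp -{1}[y]natr_Zp -natrD fn natrD.
have fD : {morph f : x y / x - y}.
  by move=> x y; apply/eqP; rewrite eq_sym subr_eq -fA subrK.
have fM : {morph f : x y / x * y}.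
  by move=> x y; rewrite -{1}[x]natr_Zp -{1}[y]natr_Zp -natrM fn natrM.
have f1 : f 1 = 1 by rewrite -[1]/(1%:R) fn.
pose red : {rmorphism 'Z_(p ^ 2) -> 'F_p} := HB.pack f
  (GRing.isZmodMorphism.Build _ _ f fD)
  (GRing.isMonoidMorphism.Build _ _ f (conj f1 fM)).
exists red; first by rewrite -natrM mulnn pchar_Zp.
move=> x; rewrite -[red x]/(f x) => /eqP; rewrite Fp_nat_eq0 // => /dvdnP[k xk].
by exists k%:R; rewrite -natrM mulnC -xk natr_Zp.
Qed.

Section Representation.

Variables (p : nat).
Hypothesis p_pr : prime p.

Notation R := 'Z_(p ^ 2).

Let p21 : (1 < p ^ 2)%N.
Proof. by have p1 := prime_gt1 p_pr; rewrite -mulnn; nia. Qed.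

(** Relating [x] and [r] through a common fraction avoids having to define the
    reduction of a [p]-integral rational and to prove it well defined. *)
Definition represents (x : rat) (r : R) :=
  exists n d : int, [/\ ~~ (p %| d)%Z, x * d%:~R = n%:~R & r * d%:~R = n%:~R].

Lemma Zp2_nat_eq0 (n : nat) : (n%:R == 0 :> R) = (p ^ 2 %| n)%N.
Proof.
by rewrite -val_eqE /= val_Zp_nat.
Qed.

Lemma Zp2_int_eq0 (n : int) : (n%:~R == 0 :> R) = (p%:Z ^+ 2 %| n)%Z.
Proof.
rewrite -natz -natrX natz dvdzE /=; case: n => n; first by rewrite -pmulrn Zp2_nat_eq0.
by rewrite NegzE mulrNz oppr_eq0 -pmulrn Zp2_nat_eq0.
Qed.

Lemma Euclid_dvdz (x y : int) : (p %| x * y)%Z = (p %| x)%Z || (p %| y)%Z.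
Proof. by rewrite !dvdzE abszM Euclid_dvdM. Qed.

Lemma represents_int (n : int) : represents n%:~R n%:~R.
Proof.
exists n, 1; rewrite !mulr1; split=> //.
by rewrite dvdzE /= dvdn1 gtn_eqF // prime_gt1.
Qed.

Lemma representsD x y r s :
  represents x r -> represents y s -> represents (x + y) (r + s).
Proof.
move=> [n [d [pd xn rn]]] [m [e [pe ym sm]]].
exists (n * e + m * d), (d * e); rewrite Euclid_dvdz negb_or pd pe.
rewrite !rmorphD !rmorphM /= -xn -ym -rn -sm; split=> //; ring.
Qed.

Lemma representsN x r : represents x r -> represents (- x) (- r).
Proof.
by move=> [n [d [pd xn rn]]]; exists (- n), d; rewrite !mulNr xn rn !rmorphN.
Qed.

Lemma Zp2_int_unit (d : int) : ~~ (p %| d)%Z -> d%:~R \is a @GRing.unit R.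
Proof.
have nu (n : nat) : ~~ (p %| n)%N -> n%:R \is a @GRing.unit R.
  by move=> pn; rewrite unitZpE // coprimeXl // prime_coprime.
rewrite dvdzE; case: d => n /= pn; first by rewrite -pmulrn nu.
by rewrite NegzE mulrNz unitrN -pmulrn nu.
Qed.

Lemma represents_div x r (d : int) : ~~ (p %| d)%Z ->
  represents x r -> represents (x / d%:~R) (r / d%:~R).
Proof.
move=> pd [n [e [pe xn rn]]]; exists n, (d * e).
have d0 : d%:~R != 0 :> rat by rewrite intr_eq0; apply: contra pd => /eqP ->; rewrite dvdz0.
rewrite Euclid_dvdz negb_or pd pe !rmorphM /= -xn -rn; split=> //.
  by rewrite mulrA divfK.
by rewrite mulrA divrK // Zp2_int_unit.
Qed.

Lemma represents_sum n (F : nat -> rat) (G : nat -> R) :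
  (forall i, represents (F i) (G i)) ->
  represents (\sum_(0 <= i < n) F i) (\sum_(i < n) G i).
Proof.
move=> FG; rewrite -(big_mkord xpredT G).
elim/big_rec2: _ => [|i x y _ xy]; last exact: representsD.
by have := represents_int 0; rewrite !mulr0z.
Qed.

Lemma in_locZ (x : rat) (n d : int) : ~~ (p %| d)%Z -> x * d%:~R = n%:~R ->
  x \in locZ p.
Proof.
move=> pd; rewrite -{1}[x]divq_num_den => xn.
have {xn} e : numq x * d = n * denq x.
  apply/eqP; rewrite -(eqr_int rat) !rmorphM /= -xn.
  by rewrite mulrAC divfK // intr_eq0 denq_neq0.
rewrite inE /locZ /= /coprimez -[_ == 1]/(coprime p `|denq x|%N) prime_coprime //.
apply/negP => pq.
have : (p %| numq x * d)%Z by rewrite e dvdz_mull.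
rewrite Euclid_dvdz (negPf pd) orbF dvdzE /= => pn.
have := coprime_num_den x; rewrite /coprime => /eqP g1.
by have := prime_gt1 p_pr; have : (p %| 1)%N by [rewrite -g1 dvdn_gcd pn pq]; rewrite dvdn1; lia.
Qed.

Lemma represents_eqmod x y r :
  represents x r -> represents y r -> locZ_eqmod p 2 x y.
Proof.
move=> [n [d [pd xn rn]]] [m [e [pe ym rm]]].
split; [exact: in_locZ pd xn | exact: in_locZ pe ym |].
have pde : ~~ (p %| d * e)%Z by rewrite Euclid_dvdz negb_or pd pe.
have : (p%:Z ^+ 2 %| n * e - m * d)%Z.
  rewrite -Zp2_int_eq0 rmorphB !rmorphM /= -rn -rm.
  by apply/eqP; ring.
case/dvdzP => k kE.
have de0 : (d * e)%:~R != 0 :> rat.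
  by rewrite intr_eq0; apply: contra pde => /eqP ->; rewrite dvdz0.
exists (k%:~R / (d * e)%:~R).
  by apply: (in_locZ (n := k) pde); rewrite divfK.
apply: (mulIf de0); rewrite -mulrA divfK //.
have := congr1 (fun i => i%:~R : rat) kE.
rewrite rmorphB !rmorphM /= -xn -ym -!pmulrn => kR.
by rewrite expr2 [RHS]mulrC -kR; ring.
Qed.

End Representation.

(** * The Gaussian integer attached to the sum *)

Lemma even_intP (a : int) : (2 %| a)%Z -> exists c, a = 2 * c.
Proof. by move=> a2; exists (a %/ 2)%Z; lia. Qed.

Lemma odd_intP (a : int) : ~~ (2 %| a)%Z -> exists c, a = 2 * c + 1.
Proof. by move=> a2; exists (a %/ 2)%Z; lia. Qed.

Lemma odd_int (c : int) : ~~ (2 %| 2 * c + 1)%Z.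
Proof. lia. Qed.

Lemma even_square_diff (n : int) : exists t, n * n = n + 2 * t.
Proof.
have [/even_intP[k e]|/odd_intP[k e]] := boolP (2 %| n)%Z.
  by exists (2 * k * k - k); rewrite e; ring.
by exists (2 * k * k + k); rewrite e; ring.
Qed.

(** The prime [p] divides [(a x - b y) (a x + b y)]. If it divides [u = a x - b y],
    then [u^2 + v^2 = p^2] with [v = a y + b x], and [u] is odd, so [v = 0]. *)
Lemma two_squares_unique (p : nat) (a b x y : int) : prime p -> odd p ->
    p%:Z = a ^+ 2 + b ^+ 2 -> p%:Z = x ^+ 2 + y ^+ 2 ->
    ~~ (2 %| a)%Z -> ~~ (2 %| x)%Z -> x = a \/ x = - a.
Proof.
move=> p_pr p_odd pab pxy a2 x2.
have p0 := prime_gt0 p_pr.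
have b2 : (2 %| b)%Z.
  case/boolP: (2 %| b)%Z => // /odd_intP[d dE].
  have [c cE] := odd_intP a2.
  have : p%:Z = 2 * (2 * (c * c) + 2 * c + 2 * (d * d) + 2 * d + 1).
    by rewrite pab cE dE; ring.
  by clear -p_odd; lia.
have main y' : p%:Z = x ^+ 2 + y' ^+ 2 -> (p %| a * x - b * y')%Z -> x = a \/ x = - a.
  move=> pxy'; set u := a * x - b * y'; set v := a * y' + b * x => pu.
  have uv : u * u + v * v = p%:Z * p%:Z by rewrite {1}pab pxy' /u /v; ring.
  have u2 : ~~ (2 %| u)%Z.
    have [c cE] := odd_intP a2; have [d dE] := odd_intP x2.
    have [e eE] := even_intP b2.
    have -> : u = 2 * (2 * (c * d) + c + d - e * y') + 1.
      by rewrite /u cE dE eE; ring.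
    exact: odd_int.
  have [k kE] := dvdzP pu.
  have k0 : k != 0 by apply: contra u2 => /eqP k0; rewrite kE k0 mul0r dvdz0.
  have k1 : 0 < k * k by rewrite -expr2 exprn_even_gt0.
  have v0 : v = 0.
    have : v * v = (1 - k * k) * (p%:Z * p%:Z).
      by apply: (addrI (u * u)); rewrite uv kE; ring.
    move=> e; have : v * v <= 0.
      by rewrite e mulr_le0_ge0 ?mulr_ge0 //; lia.
    by rewrite -expr2 exprn_even_le0 // => /eqP.
  have k2 : k * k = 1.
    have : (k * k) * (p%:Z * p%:Z) = 1 * (p%:Z * p%:Z).
      by rewrite mul1r -[RHS]uv v0 kE; ring.
    by apply: mulIf; rewrite mulf_neq0 //; lia.
  have e : x = a * k.
    apply: (mulIf (x := p%:Z)); first by lia.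
    transitivity (a * u + b * v); first by rewrite {1}pab /u /v; ring.
    by rewrite v0 kE; ring.
  have : (k - 1) * (k + 1) == 0 by apply/eqP; transitivity (k * k - 1); [ring | rewrite k2].
  by rewrite mulf_eq0 subr_eq0 addr_eq0 => /orP[]/eqP kE'; rewrite e kE'; [left|right]; ring.
have : (p %| (a * x - b * y) * (a * x - b * - y))%Z.
  apply/dvdzP; exists (x ^+ 2 - b ^+ 2).
  transitivity (a ^+ 2 * x ^+ 2 - b ^+ 2 * y ^+ 2); first by ring.
  have -> : y ^+ 2 = p%:Z - x ^+ 2 by rewrite pxy; ring.
  by rewrite pab; ring.
rewrite Euclid_dvdz // => /orP[]; first exact: main.
by apply: main; rewrite sqrrN.
Qed.

Lemma square_mod3 (a : int) :
  ((3 %| a)%Z /\ exists t, a * a = 3 * t) \/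
  (~~ (3 %| a)%Z /\ exists t, a * a = 3 * t + 1).
Proof.
have [k [e|[e|e]]] : exists k, a = 3 * k \/ (a = 3 * k + 1 \/ a = 3 * k - 1).
  by exists ((a + 1) %/ 3)%Z; lia.
- by left; split; [lia | exists (3 * k * k); rewrite e; ring].
- by right; split; [lia | exists (3 * k * k + 2 * k); rewrite e; ring].
- by right; split; [lia | exists (3 * k * k - 2 * k); rewrite e; ring].
Qed.

(** The norm determines [K] up to a unit and conjugation. The congruence
    determines the unit: the real part of [K] is [-1] or [1] modulo [4] according
    to the parity of [q], which is that of half its imaginary part. *)
Lemma quartic_jacobi_sum_primary (p : nat) (a b : int) (K w : gaussInt) :
    prime p -> (p %% 4 = 1)%N -> p%:Z = a ^+ 2 + b ^+ 2 -> (4 %| a - 1)%Z ->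
    K * gauss_conj K = p%:R -> K + p%:R = (1 - gauss_i) * 2 * w ->
  exists2 b', b' = b \/ b' = - b & - (-1) ^+ (p %/ 4) * gauss_conj K = (a, b').
Proof.
move=> p_pr p4 pab a4; case: K w => x y [c d].
rewrite gauss_mul_conj gauss_intE gauss_natE => -[]; rewrite /gauss_norm /= => pxy.
rewrite gauss_natE => -[xE yE].
have {}xE : x + p%:Z = 2 * c + 2 * d by rewrite xE /=; ring.
have {}yE : y = 2 * (d - c) by move: yE; rewrite addr0 => -> /=; ring.
have pq : p%:Z = 4 * (p %/ 4)%N%:Z + 1 by lia.
set q := (p %/ 4)%N in pq *.
have a2 : ~~ (2 %| a)%Z by lia.
have x2 : ~~ (2 %| x)%Z by lia.
have op : odd p by lia.
have [m mE] := odd_intP x2.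
(* With x = 2 m + 1 and y = 2 (d - c), this is p = 4 q + 1; as m^2 + m is even,
   d - c has the parity of q. *)
have e1 : m * m + m = q%:Z - (d - c) * (d - c).
  apply: (mulfI (x := 4)) => //; transitivity (x ^+ 2 - 1); first by rewrite mE; ring.
  transitivity (p%:Z - 1 - y ^+ 2); first by rewrite -pxy; ring.
  by rewrite pq yE; ring.
have [t1 t1E] := even_square_diff m.
have [t2 t2E] := even_square_diff (d - c).
have xa := two_squares_unique p_pr op pab (esym pxy) a2 x2.
have yb : y = b \/ y = - b.
  have : (y - b) * (y + b) == 0.
    apply/eqP; transitivity (y ^+ 2 - b ^+ 2); first by ring.
    have : x ^+ 2 = a ^+ 2 by case: xa => ->; rewrite ?sqrrN.
    by move=> e; move: pab; rewrite -pxy e => /addrI ->; rewrite subrr.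
  by rewrite mulf_eq0 subr_eq0 addr_eq0 => /orP[]/eqP; [left|right].
rewrite -signr_odd; case: (boolP (odd q)) => oq.
- have {xa} xa : x = a by clear -mE t1E t2E e1 xE a4 xa pq oq; lia.
  exists (- y); first by case: yb => ->; rewrite ?opprK; [right|left].
  by rewrite expr1 opprK mul1r xa.
- have {xa} xa : x = - a by clear -mE t1E t2E e1 xE a4 xa pq oq; lia.
  exists y => //.
  rewrite expr0 mulN1r /gauss_conj /= xa; congr (_, _) => /=; by rewrite opprK.
Qed.

Lemma quartic_value_mod3 (e : gaussInt) (s t : int) :
    e \in quartic_values -> e != 0 ->
  [/\ e.1 = 3 * s + 1 -> e = 1, e.1 = 3 * s - 1 -> e = -1,
      e.1 = 3 * s -> e.2 = 3 * t + 1 -> e = gauss_i &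
      e.1 = 3 * s -> e.2 = 3 * t - 1 -> e = - gauss_i].
Proof.
move=> ev e0; move: ev; rewrite !inE (negPf e0) /= {e0}.
by case/or4P => /eqP -> /=; split=> //; lia.
Qed.

(** The four units are distinct modulo [3], so the residues of [a^2 - b^2] and of
    [- 2 a b] single out [e]. *)
Lemma quartic_sign_mod3 (a b : int) (e w : gaussInt) :
    e \in quartic_values -> e != 0 ->
    gauss_conj (a, b) ^+ 2 = e + w *+ 3 ->
  [/\ ~~ (3 %| a)%Z -> (3 %| a ^+ 2 + b ^+ 2 - 1)%Z -> e = 1,
      (3 %| a)%Z -> (3 %| a ^+ 2 + b ^+ 2 - 1)%Z -> e = -1,
      (3 %| a ^+ 2 + b ^+ 2 - 2)%Z -> (3 %| a - b)%Z -> e = gauss_i &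
      (3 %| a ^+ 2 + b ^+ 2 - 2)%Z -> (3 %| a + b)%Z -> e = - gauss_i].
Proof.
move=> ev e0; case: w => c d E.
have E' : gauss_conj (a, b) * gauss_conj (a, b) = (e.1 + 3 * c, e.2 + 3 * d).
  by rewrite -expr2 E gauss_addE; congr (_, _) => /=; ring.
have r1 : a * a - b * b = e.1 + 3 * c.
  by have := congr1 fst E'; rewrite /= => <-; ring.
have r2 : - (2 * (a * b)) = e.2 + 3 * d.
  by have := congr1 snd E'; rewrite /= => <-; ring.
have sa := square_mod3 a; have sb := square_mod3 b.
have V s t := @quartic_value_mod3 e s t ev e0.
rewrite !expr2; clear E E' ev e0; split.
- move=> a3 /dvdzP[k kE]; case: sa => -[a3' [t tE]]; first by rewrite a3' in a3.
  by have [v _ _ _] := V (2 * t - k - c) 0; apply: v; clear -r1 kE tE; lia.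
- move=> a3 /dvdzP[k kE]; case: sa => -[a3' [t tE]]; last by rewrite a3 in a3'.
  by have [_ v _ _] := V (2 * t - k - c) 0; apply: v; clear -r1 kE tE; lia.
- move=> /dvdzP[k kE] /dvdzP[l lE].
  have ab : 2 * (a * b) = a * a + b * b - 9 * (l * l).
    by have -> : a = l * 3 + b; [rewrite -lE | ]; ring.
  have [t tE] : exists t, a * a = 3 * t + 1.
    case: sa => -[_ [t tE]]; last by exists t.
    by case: sb => -[_ [t' tE']]; clear -kE tE tE'; lia.
  have [_ _ v _] := V (2 * t - k - c) (- k - 1 + 3 * (l * l) - d).
  by apply: v; [clear -r1 kE tE | clear -r2 ab kE]; lia.
- move=> /dvdzP[k kE] /dvdzP[l lE].
  have ab : 2 * (a * b) = 9 * (l * l) - a * a - b * b.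
    by have -> : a = l * 3 - b; [rewrite -lE | ]; ring.
  have [t tE] : exists t, a * a = 3 * t + 1.
    case: sa => -[_ [t tE]]; last by exists t.
    by case: sb => -[_ [t' tE']]; clear -kE tE tE'; lia.
  have [_ _ _ v] := V (2 * t - k - c) (k + 1 - 3 * (l * l) - d).
  by apply: v; [clear -r1 kE tE | clear -r2 ab kE]; lia.
Qed.

(** If [p] divided the real part of [z], the norm [p] would be divisible by
    [p^2]. *)
Lemma gauss_unit_root_coprime (p : nat) (z : gaussInt) : prime p -> odd p ->
  z * gauss_conj z = p%:R -> ~~ (p %| 2 * z.1)%Z.
Proof.
move=> p_pr p_odd; have p1 := prime_gt1 p_pr.
rewrite gauss_mul_conj gauss_intE gauss_natE => -[]; rewrite /gauss_norm.
case: z => x y /= xy; apply/negP; rewrite Euclid_dvdz // => /orP[|px].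
  by rewrite dvdzE /= => /dvdn_leq; have : p <> 2%N by [move=> e; rewrite e in p_odd]; lia.
have py : (p %| y)%Z.
  have : (p %| y * y)%Z.
    have -> : y * y = p%:Z - x * x by rewrite -xy; ring.
    by rewrite rpredB ?dvdzz ?dvdz_mull.
  by rewrite Euclid_dvdz // orbb.
case/dvdzP: px => k kE; case/dvdzP: py => l lE.
have e1 : p%:Z * 1 = p%:Z * (p%:Z * (k * k + l * l)).
  by rewrite mulr1 -{1}xy kE lE; ring.
have : (p %| 1)%Z.
  apply/dvdzP; exists (k * k + l * l); rewrite mulrC.
  by apply: (mulfI _ e1); lia.
by rewrite dvdzE /= dvdn1; lia.
Qed.

Lemma sextic_sum_eqmod (p : nat) (a b : int) :
    prime p -> (p %% 4 = 1)%N -> ~~ (3 %| p)%N ->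
    p%:Z = a ^+ 2 + b ^+ 2 -> (4 %| a - 1)%Z ->
  exists b' e w, [/\ b' = b \/ b' = - b, e \in quartic_values, e != 0,
    gauss_conj (a, b') ^+ 2 = e + w *+ 3 &
    let c := ((-1) ^+ (p %/ 12 + p %/ 4) * e * (a, b') : gaussInt).1 in
    locZ_eqmod p 2
      (\sum_(0 <= k < p) 'C(6 * k, 3 * k)%:R * 'C(3 * k, k)%:R / 864 ^+ k)
      (2 * c%:~R - p%:R / (2 * c%:~R))].
Proof.
move=> p_pr p4 p3 pab a4; have p1 := prime_gt1 p_pr; have p_odd : odd p by lia.
have [i0 i0_sqr] := Fp_sqrt_m1 p_pr p4.
pose chi := quartic_char i0.
have chi_v : forall x, chi x \in quartic_values := quartic_char_values i0.
have chi_e : forall x, gauss_eval i0 (chi x) = x ^+ (p %/ 4).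
  exact: quartic_char_eval.
pose K := quartic_jacobi_sum chi.
have normK : K * gauss_conj K = p%:R.
  exact: (quartic_jacobi_sum_norm p_pr p4 i0_sqr chi_v chi_e).
have [w4 w4E] : exists w, K + p%:R = (1 - gauss_i) * 2 * w.
  exact: (quartic_jacobi_sum_mod4 p_pr p4 i0_sqr chi_v chi_e).
have [w wE] : exists w, K ^+ 2 = chi 4 * chi 3 + w *+ 3.
  by apply: (quartic_jacobi_sum_mod3 p_pr p4 i0_sqr chi_v chi_e); apply: negbTE.
have chi4 : chi 4 = (-1) ^+ (p %/ 4) by exact: (quartic_char4 p_pr p4 i0_sqr chi_v chi_e).
have [b' bb' kE] := quartic_jacobi_sum_primary p_pr p4 pab a4 normK w4E.
have sqs m : (-1) ^+ m * (-1) ^+ m = 1 :> gaussInt.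
  by rewrite -exprMn mulrNN mulr1 expr1n.
have three0 : (3 : 'F_p) != 0 by rewrite Fp_nat_neq0 //=; lia.
have n3 : chi 3 * gauss_conj (chi 3) = 1 by exact: (quartic_char_conj chi_v chi_e three0).
pose e := (-1) ^+ (p %/ 4) * chi 3.
have sv m : (-1) ^+ m \in quartic_values.
  by rewrite -signr_odd; case: (odd m).
have conjK x : gauss_conj (gauss_conj x) = x.
  by case: x => x y; rewrite /gauss_conj /= opprK.
have conj_sign m : gauss_conj ((-1) ^+ m) = (-1) ^+ m.
  by rewrite -signr_odd; case: (odd m).
have conjN x : gauss_conj (- x) = - gauss_conj x.
  by case: x.
exists b', e, w; split=> //.
- by rewrite quartic_valuesM.
- apply/eqP => e0; have : 1 = 0 :> gaussInt.
    transitivity (e * ((-1) ^+ (p %/ 4) * gauss_conj (chi 3))); last by rewrite e0 mul0r.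
    transitivity (((-1) ^+ (p %/ 4) * (-1) ^+ (p %/ 4)) * (chi 3 * gauss_conj (chi 3))).
      by rewrite sqs n3 mulr1.
    by rewrite /e; ring.
  by [].
- rewrite -kE gauss_conjM conjK conjN conj_sign.
  transitivity (((-1) ^+ (p %/ 4) * (-1) ^+ (p %/ 4)) * K ^+ 2); first by ring.
  by rewrite sqs mul1r wE chi4.
set z := (X in let c := X.1 in _).
move=> c.
have zE : z = - (-1) ^+ (p %/ 12 + p %/ 4) * chi 3 * gauss_conj K.
  rewrite /z -kE /e exprD.
  transitivity ((-1) ^+ (p %/ 12) * ((-1) ^+ (p %/ 4) * (-1) ^+ (p %/ 4)) *
    chi 3 * (- (-1) ^+ (p %/ 4) * gauss_conj K)); first by ring.
  by rewrite sqs; ring.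
have zz : z * gauss_conj z = p%:R.
  rewrite zE !gauss_conjM conjN conj_sign conjK.
  transitivity (((-1) ^+ (p %/ 12 + p %/ 4) * (-1) ^+ (p %/ 12 + p %/ 4)) *
    (chi 3 * gauss_conj (chi 3)) * (K * gauss_conj K)); first by ring.
  by rewrite sqs n3 normK !mul1r.
have pc : ~~ (p %| 2 * c)%Z by exact: gauss_unit_root_coprime.
have [red sqr_p red_ker] := reduction_mod_p p_pr.
have [Su SE] := sextic_sum_gauss_eval p_pr sqr_p red_ker p4 i0_sqr chi_v chi_e p3.
rewrite -/K -zE in SE; rewrite SE in Su.
have iI := teichmuller_i_sqr p_pr sqr_p red_ker p4 i0_sqr.
have cu : (2 * c%:~R : 'Z_(p ^ 2)) \is a GRing.unit.
  by have := Zp2_int_unit p_pr pc; rewrite rmorphM.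
have uz := gauss_eval_unit_root sqr_p iI Su zz cu.
apply: (@represents_eqmod _ p_pr _ _ (gauss_eval (teichmuller 'Z_(p ^ 2) i0) z)).
  rewrite -SE.
  apply: (@represents_sum p p_pr p
    (fun k => 'C(6 * k, 3 * k)%:R * 'C(3 * k, k)%:R / 864 ^+ k)
    (fun k => 'C(6 * k, 3 * k)%:R * 'C(3 * k, k)%:R / 864 ^+ k)) => k.
  have p864 : ~~ (p %| 864%:Z ^+ k)%Z.
    rewrite dvdzE abszX Euclid_dvdX // negb_and -[`|864|%N]/(2 ^ 5 * 3 ^ 3)%N.
    rewrite Euclid_dvdM // !Euclid_dvdX // !andbT; apply/orP; left.
    by rewrite negb_or !gtnNdvd //; clear -p1 p4; lia.
  have := represents_div p_pr p864
    (represents_int p_pr ('C(6 * k, 3 * k) * 'C(3 * k, k))%N).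
  by rewrite !rmorphXn /= -!pmulrn !natrM.
have c2 := represents_int p_pr (2 * c); rewrite rmorphM /= in c2.
have := represents_div p_pr pc (represents_int p_pr p%:Z).
rewrite uz !rmorphM /= -!pmulrn => /(representsN).
by move/(representsD p_pr c2); rewrite rmorphM.
Qed.

Theorem theorem3p2 (p : nat) (a b : int)
    (p_prime : prime p) (p_mod4 : p = 1 %[mod 4])
    (p_sum : p%:Z = a ^+ 2 + b ^+ 2) (a_mod4 : (4 %| a - 1)%Z) :
  let S : rat :=
    \sum_(0 <= k < p) 'C(6 * k, 3 * k)%:R * 'C(3 * k, k)%:R / 864 ^+ k in
  [/\ p = 1 %[mod 12] -> ~~ (3 %| a)%Z ->
        locZ_eqmod p 2 S (2 * a%:~R - p%:R / (2 * a%:~R)),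
      p = 1 %[mod 12] -> (3 %| a)%Z ->
        locZ_eqmod p 2 S (- 2 * a%:~R + p%:R / (2 * a%:~R)) &
      p = 5 %[mod 12] -> (3 %| a - b)%Z ->
        locZ_eqmod p 2 S (2 * b%:~R - p%:R / (2 * b%:~R))].
Proof.
move=> S.
have main : ~~ (3 %| p)%N -> _ := fun p3 => sextic_sum_eqmod p_prime p_mod4 p3 p_sum a_mod4.
have signE (m : nat) : (-1) ^+ m = (if odd m then -1 else 1) :> gaussInt.
  by rewrite -signr_odd; case: (odd m).
have odd1 : (p %% 12 = 1)%N -> odd (p %/ 12 + p %/ 4) = false by clear; lia.
have odd5 : (p %% 12 = 5)%N -> odd (p %/ 12 + p %/ 4) = true by clear; lia.
split=> p12 h.
- have [|b' [e [w [bb' ev e0 eE]]]] := main; first by clear -p12; lia.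
  rewrite signE odd1 //.
  have [e1 _ _ _] := quartic_sign_mod3 ev e0 eE.
  rewrite {}e1 //; last first.
    have -> : b' ^+ 2 = b ^+ 2 by case: bb' => ->; rewrite ?sqrrN.
  by rewrite -p_sum; clear -p12; lia.
  by rewrite mul1r mul1r.
- have [|b' [e [w [bb' ev e0 eE]]]] := main; first by clear -p12; lia.
  rewrite signE odd1 //.
  have [_ e1 _ _] := quartic_sign_mod3 ev e0 eE.
  rewrite {}e1 //; last first.
    have -> : b' ^+ 2 = b ^+ 2 by case: bb' => ->; rewrite ?sqrrN.
  by rewrite -p_sum; clear -p12; lia.
  rewrite mul1r mulN1r /= rmorphN /= !mulrN invrN mulrN opprK.
  by rewrite mulNr.
have [|b' [e [w [bb' ev e0 eE]]]] := main; first by clear -p12; lia.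
rewrite signE odd5 //.
have [_ _ ei eNi] := quartic_sign_mod3 ev e0 eE.
have b2 : (3 %| a ^+ 2 + b' ^+ 2 - 2)%Z.
  have -> : b' ^+ 2 = b ^+ 2 by case: bb' => ->; rewrite ?sqrrN.
  by rewrite -p_sum; clear -p12; lia.
have [bE|bE] := bb'.
  rewrite bE in b2 ei *; rewrite ei //.
  have -> : -1 * gauss_i * (a, b) = (b, - a) :> gaussInt by congr (_, _) => /=; ring.
  by [].
rewrite bE in b2 eNi *; rewrite eNi //.
have -> : -1 * - gauss_i * (a, - b) = (b, a) :> gaussInt by congr (_, _) => /=; ring.
by [].
Qed.
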